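(* Let $P(x,dy)$ be a probability kernel on a measurable space $(S,\mathcal S)$, let $h:S\to[0,\infty)$ be harmonic with respect to $P$, and let $o\in S$ with $h(o)>0$. On some probability space let $\check X^*=(\check X^*_n)_{n\ge 0}$ be a Markov chain with transition kernel $P$ and initial state $\check X_0^*=o$, and let $U$ be a random variable independent of $\check X^*$ and uniformly distributed in the interval $(0,h(o))$. Define the random variable $$T^*:=\sup\{n\ge 0 : h(\check X^*_m)>h(\check X^*_n)\ge U \text{ for all } m<n\}\in\{0,1,2,\ldots\}\cup\{\infty\}.$$ Moreover, on the event $\{T^*<\infty\}$ let $\hat X^*=(\hat X^*_n)_{n\ge0}$ be a process starting in $\hat X^*_0=\check X^*_{T^*}$, whose conditional distribution, given $\check X^*$ and $U$, is equal to that of a Markov chain with transition kernel $P^h$ (with initial state $\check X^*_{T^*}$) conditioned to stay inside $\{x\in S: h(x)\ge h(\check X^*_{T^*})\}$ for all times. Then the process $\bar X^*=(\bar X^*_n)_{n\ge0}$ given by $$\bar X^*_n:=\begin{cases}\check X^*_n, & n<T^*,\\ \hat X^*_{n-T^*}, & n\ge T^*,\end{cases}$$ (so that $\bar X^*_n=\check X^*_n$ for all $n$ if $T^*=\infty$) is a Markov chain with transition kernel $P^h$ and initial state $o$, that is, equal in distribution to $(X_n)_{n\ge0}$ under the measure $\mathbf P^h_o$.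
   Context: $(S,\mathcal S)$ is an arbitrary measurable space (no topological restrictions). A function $h:S\to[0,\infty)$ (finite-valued, measurable) is harmonic with respect to $P$ if $h(x)=\int P(x,dy)\,h(y)$ for all $x\in S$. Put $S^h:=\{x\in S: h(x)>0\}$. The $h$-transformed kernel is the probability kernel on $S^h$ given by $P^h(x,dy):=\frac{1}{h(x)}P(x,dy)h(y)$. For $x\in S^h$, $\mathbf P^h_x$ denotes the probability measure under which $(X_n)_{n\ge0}$ is a Markov chain with transition kernel $P^h$ and initial state $x$. ''A Markov chain with transition kernel $P^h$ and initial state $x\in S^h$ conditioned to stay inside $\{y: h(y)\ge s\}$'', where $h(x)\ge s>0$, means the process $(X_n)_{n\ge0}$ under the conditional law $\mathbf P^h_x(\,\cdot\mid h(X_i)\ge s\ \forall i\ge 0)$; here it is used with $x=\check X^*_{T^*}$ and $s=h(\check X^*_{T^*})$. (The conditioning event has strictly positive probability.) *)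

(* Defs.v *)
From HB Require Import structures.
From mathcomp Require Import all_boot all_order all_algebra.
From mathcomp Require Import all_classical all_reals all_analysis.

Set Implicit Arguments.
Unset Strict Implicit.
Unset Printing Implicit Defensive.

Import Order.TTheory GRing.Theory Num.Theory.

Local Open Scope classical_set_scope.
Local Open Scope ring_scope.
Local Open Scope ereal_scope.

(* The path space T^nat with the product sigma-algebra, i.e. the smallest one
   making all coordinates measurable. *)
Definition coordinate_sets d (T : measurableType d) : set (set (nat -> T)) :=
  \bigcup_n preimage_set_system setT (fun w : nat -> T => w n) measurable.

Notation paths T := (g_sigma_algebraType (@coordinate_sets _ T)).

Definition coordinate d (T : measurableType d) (n : nat) (w : paths T) : T :=
  w n.

Definition trajectory d (T : measurableType d) (Omega : Type)
  (X : nat -> Omega -> T) (w : Omega) : paths T := fun n => X n w.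

Definition history d (T : measurableType d) (Omega : Type)
    (X : nat -> Omega -> T) (n : nat) : set (set Omega) :=
  <<s \bigcup_(i in [set i | (i <= n)%N])
        preimage_set_system setT (X i) measurable >>.

(* [markov_chain M D K x X]: under M, the process X is a Markov chain with state
   space D, transition kernel K and initial state x.  The last clause is
   M(X_{n+1} \in B | X_0, ..., X_n) = K(X_n, B).  The initial state is imposed
   as "X_0 has law delta_x": {x} need not be measurable.  A measure on a
   measurable subset D of T is seen as a measure on T carried by D, so only the
   values of K at points of D matter. *)
Definition markov_chain dO (Omega : measurableType dO) d (T : measurableType d)
    (R : realType) (M : probability Omega R) (D : set T)
    (K : T -> set T -> \bar R) (x : T) (X : nat -> Omega -> T) : Prop :=
  [/\ forall n, measurable_fun setT (X n),
      forall n, {ae M, forall w, D (X n w)},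
      forall B, measurable B -> M (X 0%N @^-1` B) = \d_x B
    & forall n A B, history X n A -> measurable B ->
        M (A `&` X n.+1 @^-1` B) = \int[M]_(w in A) K (X n w) B].

Definition harmonic_wrt d (S : measurableType d) (R : realType)
    (P : R.-pker S ~> S) (h : S -> R) : Prop :=
  forall x, (h x)%:E = \int[P x]_y (h y)%:E.

Definition positivity_set (S : Type) (R : realType) (h : S -> R) : set S :=
  [set x | (0 < h x)%R].

(* P^h(x, dy) = h(x)^-1 P(x, dy) h(y) for x in the positivity set of h, on which
   it is carried; identically 0 (junk) at the other points. *)
Definition htransform d (S : measurableType d) (R : realType)
    (P : R.-pker S ~> S) (h : S -> R) (x : S) (A : set S) : \bar R :=
  (h x)^-1%:E * \int[P x]_(y in A) (h y)%:E.

Definition cond_prob d (T : measurableType d) (R : realType)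
    (Q : probability T R) (E B : set T) : \bar R :=
  Q (B `&` E) * (fine (Q E))^-1%:E.

Definition stay_above d (S : measurableType d) (R : realType)
    (h : S -> R) (s : R) : set (paths S) :=
  [set w | forall i, (s <= h (coordinate i w))%R].

Definition independent_rv dO (Omega : measurableType dO) d1
    (T1 : measurableType d1) d2 (T2 : measurableType d2) (R : realType)
    (M : probability Omega R) (Y : Omega -> T1) (Z : Omega -> T2) : Prop :=
  forall A B, measurable A -> measurable B ->
    M (Y @^-1` A `&` Z @^-1` B) = M (Y @^-1` A) * M (Z @^-1` B).

(* On the event E, the conditional law of Z given Y is kappa; the sigma-algebra
   generated by Y consists of the Y @^-1` C with C measurable. *)
Definition conditional_law_on dO (Omega : measurableType dO) d1
    (T1 : measurableType d1) d2 (T2 : measurableType d2) (R : realType)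
    (M : probability Omega R) (E : set Omega) (Y : Omega -> T1)
    (Z : Omega -> T2) (kappa : Omega -> set T2 -> \bar R) : Prop :=
  forall C B, measurable C -> measurable B ->
    M (E `&` Y @^-1` C `&` Z @^-1` B) =
      \int[M]_(w in E `&` Y @^-1` C) kappa w B.

(* T^* = last_record (h \o X) U, an element of {0, 1, 2, ...} U {+oo}: the set
   below always contains n = 0. *)
Definition last_record (R : realType) (f : nat -> R) (u : R) : \bar R :=
  ereal_sup [set n%:R%:E | n in
    [set n : nat | forall m, (m < n)%N -> (u <= f n < f m)%R]].

(* The natural number t when t = n%:R%:E; junk value 0 when t = +oo. *)
Definition time_index (R : realType) (t : \bar R) : nat :=
  Num.truncn (fine t).

Definition splice (R : realType) (Omega S : Type) (T : Omega -> \bar R)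
    (X Y : nat -> Omega -> S) (n : nat) (w : Omega) : S :=
  if n%:R%:E < T w then X n w else Y (n - time_index (T w))%N w.

(* Main.v *)
Require Import Defs.
From HB Require Import structures.
From mathcomp Require Import all_boot all_order all_algebra.
From mathcomp Require Import all_classical all_reals all_analysis.
From mathcomp Require Import measurable_realfun giry.

(** Write [Q] for the law of the chain with kernel [P^h] started at [o], and
    [X] for the chain with kernel [P].  Everything rests on one identity.  On
    the history up to time [m] the law [Q] has density [h(X_m) / h(o)] with
    respect to the law of [X] ([integral_cylinder_htransform]).  Since [U] is
    uniform on [(0, h(o))] and independent of [X], this density is the
    conditional probability of [U <= h(X_m)], so that
    [[
      Pr (X \in A, U <= h(X_m)) = Q A
    ]]
    for every event [A] of the history up to [m] on which [h(X_m) <= h(X_0)]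
    ([level_law]): keeping only the trajectories whose height at time [m] is
    above the random level turns the [P]-chain into the [P^h]-chain.

    The time [T] is designed so that the events which matter have this form.
    One has [T > k] exactly when, at the first time [m > k] at which the height
    drops below all the heights seen up to time [k], it is still at least [U].
    Summing the identity over [m] gives
    [[
      Pr (X \in A, T > k) = Q (A, the path drops below its minimum up to k)
    ]]
    ([law_last_record_gt]).  Taking the complement inside [U <= h(X_n)], for
    events [A] of the history up to [n] on which [n] is a strict record,
    [[
      Pr (X \in A, T = n) = Q (A, the path never drops below h(X_n) after n)
    ]]
    ([law_last_record_eq]).  By the Markov property of [Q], the conditional
    probability of the event on the right given the history up to [n] is the
    probability of the conditioning event [{h(X_i) >= h(X_0) for all i}] for the
    [P^h]-chain started at [X_n].  It is also the normalising constant in the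
    law of the process glued at time [n], so it cancels: gluing the conditioned
    chain restores the law of the future under [Q] ([spliced_law]).

    It remains to compare the two laws on a cylinder, an event that depends on
    the times up to [k] only.  Where [T > k] the glued process is still [X]; the
    other values are [T = n] with [n <= k].  Under [Q] these cases correspond to
    the path dropping after [k] below its minimum up to [k], and to [n <= k]
    being the first time at which the height attains its minimum over the whole
    path.  They partition the path space, so the pieces add up
    ([spliced_cylinder]); as a cylinder only sees whether [T > k], the event
    [T = +oo] takes care of itself.

    Conditioning on the state at time [n] requires the law of the [P^h]-chain
    to depend measurably on its initial state.  This holds because the
    probabilities of cylinders are iterated integrals ([chain_cylinder]) and
    cylinders are a pi-system that generates the sigma-algebra of the path
    space. *)

Set Implicit Arguments.
Unset Strict Implicit.
Unset Printing Implicit Defensive.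

Import Order.TTheory GRing.Theory Num.Theory.

Local Open Scope classical_set_scope.
Local Open Scope ring_scope.
Local Open Scope ereal_scope.

(** * Measures determined by a pi-system, and disintegration *)

Lemma eq_measure_pi_system d (T : measurableType d) (R : realType)
    (G : set (set T)) (m1 m2 : {measure set T -> \bar R}) :
  G `<=` measurable -> setI_closed G -> G setT -> m1 setT < +oo ->
  (forall A, G A -> m1 A = m2 A) -> forall A, <<s G >> A -> m1 A = m2 A.
Proof.
move=> Gm GI GT m1oo m12.
have HE : [set X | G X /\ X `<=` setT] = G.
  by apply/seteqP; split=> [X []|X GX]//=; split.
move=> A; rewrite -{1}HE => GA.
by apply: (g_sigma_algebra_measure_unique_trace G setT measurableT _ _ m1 m2)
  GA; rewrite ?HE//; exact: m12.
Qed.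

Lemma measurable_patch d (T : measurableType d) (R : realType)
    (f : T -> \bar R) (A : set T) :
  measurable A -> measurable_fun setT f -> measurable_fun setT (f \_ A).
Proof.
by move=> mA mf; apply/(measurable_restrictT f mA); exact: measurable_funTS.
Qed.

Lemma eq_measure_null d (T : measurableType d) (R : realType)
    (mu : {measure set T -> \bar R}) (N A B : set T) :
  measurable N -> measurable A -> measurable B -> mu N = 0 ->
  (forall w, ~ N w -> A w <-> B w) -> mu A = mu B.
Proof.
move=> mN mA mB N0 AB.
have le (C E : set T) : measurable C -> measurable E ->
    C `<=` E `|` N -> mu C <= mu E.
  move=> mC mE CE; rewrite (@le_trans _ _ (mu (E `|` N)))//.
    by apply: le_measure => //; rewrite inE//; exact: measurableU.
  by have := measureU2 mu mE mN; rewrite [X in _ + X](_ : _ = 0)// adde0.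
apply/le_anti/andP; split; apply: le => // w Cw;
  by have [Nw|Nw] := pselect (N w); [right|left; apply/(AB w Nw)].
Qed.

(** For finite measures the sets on which evaluation is measurable form a
    lambda-system. *)
Lemma measurable_kernel_pi_system d (E : measurableType d) d'
    (F : measurableType d') (R : realType) (G : set (set F))
    (k : E -> {measure set F -> \bar R}) :
  G `<=` measurable -> setI_closed G -> G setT -> (forall x, k x setT < +oo) ->
  (forall A, G A -> measurable_fun setT (k ^~ A)) ->
  forall A, <<s G >> A -> measurable_fun setT (k ^~ A).
Proof.
move=> Gm GI GT koo kG.
have kfin x A : measurable A -> k x A < +oo.
  by move=> mA; rewrite (le_lt_trans _ (koo x))// le_measure// inE.
suff : <<s G >> `<=`
    [set A | measurable A /\ measurable_fun setT (k ^~ A)].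
  by move=> + A GA => /(_ _ GA) [].
apply: lambda_system_subset => //; last first.
  by move=> A GA; split; [exact: Gm|exact: kG].
split=> //.
- by split=> //; exact: kG.
- move=> A B BA [mA kA] [mB kB]; split; first exact: measurableD.
  rewrite [X in measurable_fun _ X](_ : _ = (fun x => k x A - k x B)); last first.
    by apply/funext => x; rewrite measureD ?setIidr// kfin.
  exact: emeasurable_funB.
- move=> A ndA HA; have mA n : measurable (A n) by have [] := HA n.
  split; first exact: bigcupT_measurable.
  apply: (emeasurable_fun_cvg (fun n x => k x (A n))
    (fun x => k x (\bigcup_n A n))).
    by move=> n; have [] := HA n.
  move=> x _; apply: nondecreasing_cvg_mu => //.
  exact: bigcupT_measurable.
Qed.

Section subprob_of.
Context d (T : measurableType d) (R : realType).
Variables (m : {measure set T -> \bar R}) (m1 : m setT <= 1).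

(** The bound is an argument only so that instance inference can find it. *)
Definition subprob_of of m setT <= 1 : set T -> \bar R := m.
HB.instance Definition _ := Measure.on (subprob_of m1).
HB.instance Definition _ :=
  Measure_isSubProbability.Build _ _ _ (subprob_of m1) m1.

End subprob_of.

Section restricted_law.
Context dO (Omega : measurableType dO) d (E : measurableType d).
Variables (R : realType) (M : probability Omega R) (A : set Omega).
Hypothesis mA : measurable A.

Lemma mrestr_le1 : mrestr M mA setT <= 1.
Proof. by rewrite /mrestr setTI probability_le1. Qed.

Definition restr_law (Y : Omega -> E) (mY : measurable_fun setT Y) : giry E R :=
  giry_map mY (subprob_of mrestr_le1).

Lemma restr_lawE (Y : Omega -> E) (mY : measurable_fun setT Y) B :
  restr_law mY B = M (A `&` Y @^-1` B).
Proof. by rewrite /restr_law /= /pushforward /= /mrestr setIC. Qed.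

Lemma integral_mrestr (f : Omega -> \bar R) :
  measurable_fun setT f -> (forall w, 0 <= f w) ->
  \int[mrestr M mA]_w f w = \int[M]_(w in A) f w.
Proof.
move=> mf f0.
have := @ge0_negligible_integral _ _ _ (mrestr M mA) setT (~` A) f.
move=> -> //; last 2 first.
- exact: measurableC.
- by rewrite /= /mrestr setICl measure0.
rewrite setTD setCK; apply: eq_measure_integral => B mB BA.
by rewrite /= /mrestr setIidl.
Qed.

Lemma integral_restr_law (Y : Omega -> E) (mY : measurable_fun setT Y)
    (f : E -> \bar R) :
  measurable_fun setT f -> (forall y, 0 <= f y) ->
  \int[restr_law mY]_y f y = \int[M]_(w in A) f (Y w).
Proof.
move=> mf f0; have := giry_int_map mY (subprob_of mrestr_le1) mf f0.
rewrite /giry_int => ->.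
by rewrite -integral_mrestr//; exact: measurableT_comp.
Qed.

End restricted_law.

Section disintegration_kernel.
Context dO (Omega : measurableType dO) d (E : measurableType d).
Variables (R : realType) (M : probability Omega R) (A : set Omega).
Hypothesis mA : measurable A.
Context d' (F : measurableType d').
Variables (Y : Omega -> E) (Z : Omega -> F) (K : R.-spker E ~> F).
Hypotheses (mY : measurable_fun setT Y) (mZ : measurable_fun setT Z).

Let kern (y : E) : giry F R := subprob_of (sprob_kernel_le1 K y).

Let mkern : measurable_fun setT kern.
Proof.
by apply: measurable_giry_codensity => // B mB; exact: measurable_kernel.
Qed.

Let mix : giry F R := giry_bind (restr_law M mA mY) mkern.

Let mixE B : measurable B -> mix B = \int[M]_(w in A) K (Y w) B.
Proof.
move=> mB; have := giry_int_bind (restr_law M mA mY) mkern.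
move=> /(_ (EFin \o \1_B)) H.
have <- : giry_int mix (EFin \o \1_B) = mix B.
  by rewrite /giry_int integral_indic// setIT.
rewrite H//; last by move=> x; rewrite lee_fin.
  rewrite /giry_int.
  under eq_integral do rewrite integral_indic// setIT.
  by apply: integral_restr_law => //; exact: measurable_kernel.
exact/measurable_EFinP/measurable_indic.
Qed.

(** Both sides are finite measures in [B]; the right-hand side is the law of [Y]
    on [A] bound to the kernel [K] in the Giry monad. *)
Lemma disintegration_pi_system (G : set (set F)) :
  G `<=` measurable -> setI_closed G -> G setT ->
  (forall B, G B -> M (A `&` Z @^-1` B) = \int[M]_(w in A) K (Y w) B) ->
  forall B, <<s G >> B -> M (A `&` Z @^-1` B) = \int[M]_(w in A) K (Y w) B.
Proof.
move=> Gm GI GT H B GB.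
have sGm : <<s G >> `<=` measurable.
  by apply: smallest_sub => //; exact: sigma_algebra_measurable.
rewrite -(restr_lawE M mA mZ) -mixE; last exact: sGm.
apply: (eq_measure_pi_system Gm GI GT) => //.
  by rewrite (le_lt_trans sprobability_setT)// ltry.
move=> C GC; transitivity (\int[M]_(w in A) K (Y w) C); last exact/esym/mixE/Gm.
by rewrite -H//; exact: restr_lawE.
Qed.

(** The form in which conditional laws are used: a conditional probability
    given [Y] that holds for events also holds for functions of [Z]. *)
Lemma integral_disintegration (f : F -> \bar R) :
  (forall B, measurable B ->
    M (A `&` Z @^-1` B) = \int[M]_(w in A) K (Y w) B) ->
  measurable_fun setT f -> (forall z, 0 <= f z) ->
  \int[M]_(w in A) f (Z w) = \int[M]_(w in A) \int[K (Y w)]_z f z.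
Proof.
move=> H mf f0; rewrite -(integral_restr_law M mA mZ)//.
have -> : \int[restr_law M mA mZ]_z f z = giry_int mix f.
  apply: eq_measure_integral => B mB _.
  by transitivity (\int[M]_(w in A) K (Y w) B);
    [rewrite -H//; exact: restr_lawE|exact/esym/mixE].
rewrite giry_int_bind//; apply: integral_restr_law => [|y].
  by apply: measurable_fun_integral_kernel => // B mB; exact: measurable_kernel.
exact: integral_ge0.
Qed.

End disintegration_kernel.

(** * The h-transform as a kernel *)

Section integral_density.
Context d (T : measurableType d) (R : realType).
Variables (mu nu : {measure set T -> \bar R}) (w : T -> R).
Hypotheses (mw : measurable_fun setT w) (w0 : forall x, (0 <= w x)%R).
Hypothesis nuE : forall B, measurable B -> nu B = \int[mu]_(x in B) (w x)%:E.

Import HBNNSimple.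

Let integral_density_nnsfun (f : {nnsfun T >-> R}) :
  \int[nu]_x (f x)%:E = \int[mu]_x ((f x)%:E * (w x)%:E).
Proof.
have fE x : (f x)%:E * (w x)%:E =
    \sum_(r \in range f) r%:E * ((\1_(f @^-1` [set r]) x)%:E * (w x)%:E).
  rewrite {1}fimfunE -fsumEFin// ge0_mule_fsuml; last first.
    by move=> r; rewrite EFinM nnfun_muleindic_ge0.
  by apply: eq_fsbigr => r _; rewrite EFinM muleA.
have f0 r x : 0 <= r%:E * ((\1_(f @^-1` [set r]) x)%:E * (w x)%:E).
  by rewrite muleA; apply: mule_ge0; [exact: nnfun_muleindic_ge0|rewrite lee_fin].
have mi r : measurable_fun setT (fun x => (\1_(f @^-1` [set r]) x)%:E * (w x)%:E).
  apply: emeasurable_funM; last exact/measurable_EFinP.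
  by apply/measurable_EFinP; apply: measurable_indic.
under [RHS]eq_integral do rewrite fE.
rewrite ge0_integral_fsum//; last by move=> r; exact: measurable_funeM.
rewrite integralT_nnsfun sintegralE.
apply: eq_fsbigr => r /[!inE] -[t _ <-].
rewrite ge0_integralZl//; last 2 first.
- by move=> x _; rewrite mule_ge0// lee_fin.
- by rewrite lee_fin.
congr (_ * _); rewrite nuE// integral_mkcond; apply: eq_integral => x _.
by rewrite patchE indicE; case: ifPn => xA; rewrite ?mul1e ?mul0e.
Qed.

Lemma integral_density (f : T -> \bar R) :
  measurable_fun setT f -> (forall x, 0 <= f x) ->
  \int[nu]_x f x = \int[mu]_x (f x * (w x)%:E).
Proof.
move=> mf f0; pose f_ := nnsfun_approx measurableT mf.
have f_f x : (f_ n x)%:E @[n --> \oo] --> f x by exact: cvg_nnsfun_approx.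
have fE : (fun x => f x * (w x)%:E) =
    (fun x => limn (fun n => (f_ n x)%:E * (w x)%:E)).
  apply/funext => x; apply/esym/cvg_lim => //.
  by apply: cvgeZr => //; exact: f_f.
transitivity (limn (fun n => \int[nu]_x (f_ n x)%:E)).
  rewrite -monotone_convergence//.
  - by apply: eq_integral => x _; exact/esym/cvg_lim.
  - by move=> n; exact/measurable_EFinP.
  - by move=> n x _; rewrite lee_fin.
  - by move=> x _ m n mn; rewrite lee_fin; exact/lefP/nd_nnsfun_approx.
rewrite fE monotone_convergence//.
- by apply/congr_lim/funext => n; exact: integral_density_nnsfun.
- by move=> n; apply: emeasurable_funM => //; exact/measurable_EFinP.
- by move=> n x _; rewrite mule_ge0// lee_fin.
- move=> x _ m n mn.
  have fmn : (f_ m x <= f_ n x)%R by exact/lefP/nd_nnsfun_approx.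
  by rewrite lee_wpmul2r// lee_fin.
Qed.

End integral_density.

Lemma measurable_inv (R : realType) : measurable_fun setT (@GRing.inv R).
Proof.
rewrite -(setvU [set 0%R : R]); apply/measurable_funU => //.
  exact: measurableC.
split; last exact: measurable_fun_set1.
apply: open_continuous_measurable_fun.
  by apply: closed_openC; exact: closed_eq.
by apply/in_setP => x /= /eqP x0; exact: inv_continuous.
Qed.

Section htransform_kernel.
Context d (S : measurableType d) (R : realType) (P : R.-pker S ~> S) (h : S -> R).

(** The assumptions on [h] are arguments because they are what makes the values
    sub-probability measures, depending measurably on the initial state. *)
Definition htransform_measure of measurable_fun setT h
  & (forall x, 0 <= h x)%R & harmonic_wrt P h := htransform P h.

Hypotheses (mh : measurable_fun setT h) (h_ge0 : forall x, (0 <= h x)%R).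
Hypothesis h_harmonic : harmonic_wrt P h.
Local Notation Q := (htransform_measure mh h_ge0 h_harmonic).

Let Q0 x : Q x set0 = 0.
Proof. by rewrite /htransform_measure /htransform integral_set0 mule0. Qed.

Let Q_ge0 x A : 0 <= Q x A.
Proof.
rewrite /htransform_measure /htransform mule_ge0 ?lee_fin ?invr_ge0//.
by apply: integral_ge0 => y _; rewrite lee_fin.
Qed.

Let mhE (A : set S) : measurable_fun A (EFin \o h).
Proof. exact/measurable_EFinP/measurable_funTS. Qed.

Let Q_sigma_additive x : semi_sigma_additive (Q x).
Proof.
move=> F mF tF mUF; apply: cvg_toP.
  by apply: ereal_nondecreasing_is_cvgn => m n mn; exact: lee_sum_nneg_natr.
rewrite /htransform_measure /htransform ge0_integral_bigcup//.
- rewrite nneseriesZl// => i _; apply: integral_ge0 => y _.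
  by rewrite lee_fin.
- by move=> y _; rewrite lee_fin.
Qed.

HB.instance Definition _ x :=
  isMeasure.Build _ _ _ (Q x) (Q0 x) (Q_ge0 x) (@Q_sigma_additive x).

Definition htransform_kernel : S -> {measure set S -> \bar R} := Q.

Let measurable_htransform_kernel U :
  measurable U -> measurable_fun setT (htransform_kernel ^~ U).
Proof.
move=> mU; apply: emeasurable_funM.
  by apply/measurable_EFinP; apply: measurableT_comp => //; exact: measurable_inv.
under eq_fun do rewrite integral_mkcond.
apply: measurable_fun_integral_kernel.
- by move=> V mV; exact: measurable_kernel.
- by move=> y; rewrite erestrict_ge0// => z _; rewrite lee_fin.
- exact/(measurable_restrictT _ _).1.
Qed.

HB.instance Definition _ := isKernel.Build _ _ _ _ _ htransform_kernel
  measurable_htransform_kernel.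

Let htransform_kernel_le1 :
  ereal_sup [set htransform_kernel x setT | x in setT] <= 1.
Proof.
apply/sprob_kernelP => x.
rewrite /htransform_kernel /= /htransform_measure /htransform -h_harmonic.
by rewrite -EFinM lee_fin; have [->|/mulVf->//] := eqVneq (h x) 0%R;
  rewrite mulr0.
Qed.

HB.instance Definition _ := Kernel_isSubProbability.Build _ _ _ _ _
  htransform_kernel htransform_kernel_le1.

(** Multiplying by [h x] makes the identity hold for all [x]: if [h x = 0] then
    harmonicity forces [h = 0] almost everywhere for [P x]. *)
Lemma integral_htransform (f : S -> \bar R) x :
  measurable_fun setT f -> (forall y, 0 <= f y) ->
  (h x)%:E * \int[htransform_kernel x]_y f y = \int[P x]_y (f y * (h y)%:E).
Proof.
move=> mf f0.
have mfh : measurable_fun setT (fun y => f y * (h y)%:E).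
  by apply: emeasurable_funM => //; apply/measurable_EFinP.
have fh0 y : 0 <= f y * (h y)%:E by rewrite mule_ge0// lee_fin.
have [hx0|hx0] := eqVneq (h x) 0%R.
  rewrite hx0 mul0e; apply/esym.
  have : ae_eq (P x) setT (EFin \o h) (cst 0).
    apply/ae_eq_integral_abs => //.
    rewrite -[RHS]/(0%R%:E) -hx0 h_harmonic; apply: eq_integral => y _.
    by rewrite gee0_abs// lee_fin.
  move=> hae; rewrite -(integral0 (P x) setT).
  apply: ge0_ae_eq_integral => //.
  apply: filterS hae => y /= /(_ Logic.I) hy _.
  by rewrite hy mule0.
rewrite (@integral_density _ _ _ (P x) (htransform_kernel x)
  (fun y => (h x)^-1 * h y)%R)//.
- rewrite -ge0_integralZl//; last 3 first.
  + apply: emeasurable_funM => //=.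
    by apply/measurable_EFinP; exact: measurable_funM.
  + by move=> y _; rewrite mule_ge0// lee_fin mulr_ge0// invr_ge0.
  + by rewrite lee_fin.
  apply: eq_integral => y _.
  by rewrite muleCA -EFinM mulrA divff// mul1r.
- exact: measurable_funM.
- by move=> y; rewrite mulr_ge0// invr_ge0.
- move=> B mB; rewrite /htransform_kernel /= /htransform_measure /htransform.
  rewrite -ge0_integralZl//; last 2 first.
  + by move=> y _; rewrite lee_fin.
  + by rewrite lee_fin invr_ge0.
Qed.

End htransform_kernel.

(** * Path space, histories and cylinders *)

Definition cylinder (Omega S : Type) (X : nat -> Omega -> S) (k : nat)
    (B : nat -> set S) : set Omega :=
  [set w | forall i, (i <= k)%N -> B i (X i w)].

Section history.
Context dO (Omega : measurableType dO) d (S : measurableType d).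
Variable X : nat -> Omega -> S.

(** The space [Omega] with the sigma-algebra generated by [X_0, ..., X_n], so
    that an event of the history is a measurable set of this space. *)
Definition hist_type n := g_sigma_algebraType
  (\bigcup_(i in [set i | (i <= n)%N]) preimage_set_system setT (X i) measurable).

HB.instance Definition _ n := Measurable.on (hist_type n).

Lemma history_measE n A :
  history X n A = measurable (A : set (hist_type n)).
Proof. by []. Qed.

Lemma measurable_hist_fun i n :
  (i <= n)%N -> measurable_fun setT (X i : hist_type n -> S).
Proof.
move=> ilen _ B mB; apply: sub_sigma_algebra; exists i => //.
by exists B.
Qed.

Lemma history_le m n : (m <= n)%N -> history X m `<=` history X n.
Proof.
move=> mn; apply: sub_sigma_algebra2.
by move=> A [i im HA]; exists i => //; exact: leq_trans mn.
Qed.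

Lemma history_measurable n :
  (forall i, measurable_fun setT (X i)) -> history X n `<=` measurable.
Proof.
move=> mX; apply: smallest_sub; first exact: sigma_algebra_measurable.
by move=> A [i _ [B mB <-]]; exact: mX.
Qed.

Definition cylinders n : set (set Omega) :=
  [set A | exists2 B, (forall i, measurable (B i)) & A = cylinder X n B].

Lemma cylindersI n : setI_closed (cylinders n).
Proof.
move=> _ _ [B mB ->] [C mC ->]; exists (fun i => B i `&` C i).
  by move=> i; exact: measurableI.
apply/seteqP; split=> [w [Bw Cw] i ik|w BCw].
  by split; [exact: Bw|exact: Cw].
by split=> i ik; have [] := BCw i ik.
Qed.

Lemma cylindersT n : cylinders n setT.
Proof.
exists (fun=> setT) => //.
by apply/seteqP; split=> // w _ i _.
Qed.

Lemma history_cylinder n : cylinders n `<=` history X n.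
Proof.
move=> _ [B mB ->]; rewrite history_measE.
have -> : cylinder X n B =
    \bigcap_(i in [set i | (i <= n)%N]) (X i @^-1` B i) by [].
apply: bigcap_measurableType => i /= ilen.
rewrite -[_ @^-1` _]setTI.
exact: (measurable_hist_fun ilen).
Qed.

Lemma history_sub_cylinders n : history X n `<=` <<s cylinders n >>.
Proof.
apply: smallest_sub; first exact: smallest_sigma_algebra.
move=> _ [i /= ilen [B mB <-]].
apply: sub_sigma_algebra; exists (fun j => if j == i then B else setT).
  by move=> j; case: ifP.
rewrite setTI; apply/seteqP; split=> w /=.
  by move=> Bw j _; case: eqP => // ->.
by move=> /(_ _ ilen); rewrite eqxx.
Qed.

Lemma cylinderS n B :
  cylinder X n.+1 B = cylinder X n B `&` X n.+1 @^-1` B n.+1.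
Proof.
apply/seteqP; split=> [w Bw|w [Bw Bnw] i].
  by split=> [i ilen|]; apply: Bw => //; exact: leqW.
by rewrite leq_eqVlt => /predU1P[->//|/Bw].
Qed.

End history.

Section paths.
Context d (S : measurableType d).
Local Notation coord := (@coordinate d S).

Lemma measurable_coordinate n : measurable_fun setT (coord n).
Proof.
move=> _ B mB; apply: sub_sigma_algebra; exists n => //.
by exists B.
Qed.

Lemma history_coordinate_measurable n : history coord n `<=` measurable.
Proof.
by apply: history_measurable => i; exact: measurable_coordinate.
Qed.

Lemma measurable_to_paths dO (Omega : measurableType dO) (D : set Omega)
    (f : Omega -> paths S) :
  (forall n, measurable_fun D (coord n \o f)) -> measurable_fun D f.
Proof.
move=> mf; have [mD|nmD] := pselect (measurable D); last by move=> /nmD.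
apply: (@measurability _ _ _ (paths S) _ _ (@coordinate_sets d S)) => //.
move=> _ [_ [n _ [B mB <-]] <-].
by rewrite setTI; exact: mf.
Qed.

Lemma measurable_trajectory dO (Omega : measurableType dO) (D : set Omega)
    (X : nat -> Omega -> S) :
  (forall n, measurable_fun D (X n)) -> measurable_fun D (trajectory X).
Proof. by move=> mX; exact: measurable_to_paths. Qed.

Definition shift n (w : paths S) : paths S := fun i => w (n + i)%N.

Lemma measurable_shift n : measurable_fun setT (shift n).
Proof.
by apply: measurable_to_paths => i; exact: (measurable_coordinate (n + i)).
Qed.

Definition all_cylinders : set (set (paths S)) :=
  \bigcup_n cylinders coord n.

Lemma all_cylindersI : setI_closed all_cylinders.
Proof.
move=> _ _ [m _ [B mB ->]] [n _ [C mC ->]]; exists (maxn m n) => //.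
exists (fun i => (if (i <= m)%N then B i else setT) `&`
                 (if (i <= n)%N then C i else setT)).
  by move=> i; apply: measurableI; case: ifP.
apply/seteqP; split=> [w [Bw Cw] i _|w BCw].
  by split; case: ifP => [im|//]; [exact: Bw|exact: Cw].
by split=> i im; have := BCw i; rewrite leq_max im ?orbT => /(_ isT) [].
Qed.

Lemma all_cylindersT : all_cylinders setT.
Proof. by exists 0%N => //; exact: cylindersT. Qed.

Lemma all_cylinders_measurable : all_cylinders `<=` measurable.
Proof.
move=> A [n _ /history_cylinder]; apply: history_measurable.
exact: measurable_coordinate.
Qed.

Lemma measurable_sub_all_cylinders :
  (measurable : set (set (paths S))) `<=` <<s all_cylinders >>.
Proof.
apply: smallest_sub; first exact: smallest_sigma_algebra.
move=> A [n _ [B mB BA]].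
have : history coord n A.
  by apply: sub_sigma_algebra; exists n => //=; exists B.
move=> /history_sub_cylinders; apply: sub_sigma_algebra2 => C HC.
by exists n.
Qed.

(** Transfers the history of a process to the history of the coordinates of its
    path, where all laws are compared. *)
Lemma history_trajectory dO (Omega : measurableType dO)
    (X : nat -> Omega -> S) n A :
  history X n A <-> exists2 C, history coord n C & A = trajectory X @^-1` C.
Proof.
split=> [|[C HC ->]].
- have : history X n `<=`
      preimage_set_system setT (trajectory X) (history coord n).
    apply: smallest_sub.
      exact/sigma_algebra_preimage/smallest_sigma_algebra.
    move=> _ [i /= ilen [B mB <-]]; exists (coord i @^-1` B) => //.
    apply: sub_sigma_algebra; exists i => //=; exists B => //.
    by rewrite setTI.
  by move=> /[apply] -[C HC <-]; exists C; rewrite ?setTI.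
- rewrite history_measE -[_ @^-1` _]setTI.
  have : measurable_fun setT
      (trajectory X : hist_type X n -> hist_type coord n).
    apply: (@measurability _ _ (hist_type X n) (hist_type coord n)
      setT (trajectory X) _ erefl).
    move=> _ [_ [i /= ilen [B mB <-]] <-]; rewrite !setTI.
    have := @measurable_hist_fun _ _ _ _ X _ _ ilen measurableT _ mB.
    by rewrite setTI.
  exact.
Qed.

End paths.

(** * Finite-dimensional distributions of Markov chains *)

Lemma integral_setI_preimage dO (Omega : measurableType dO) d
    (E : measurableType d) (R : realType) (M : {measure set Omega -> \bar R})
    (A : set Omega)
    (Y : Omega -> E) (B : set E) (f : E -> \bar R) :
  \int[M]_(w in A `&` Y @^-1` B) f (Y w) = \int[M]_(w in A) (f \_ B) (Y w).
Proof.
by rewrite integral_mkcondr; apply: eq_integral => w _; rewrite !patchE.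
Qed.

Section chain.
Context dO (Omega : measurableType dO) d (S : measurableType d) (R : realType).
Variables (M : probability Omega R) (D : set S) (K : R.-spker S ~> S) (x0 : S).
Variable X : nat -> Omega -> S.
Hypothesis chain : markov_chain M D (fun x A => K x A) x0 X.

Let mX n : measurable_fun setT (X n).
Proof. by have [mX _ _ _] := chain. Qed.

Let mhist n : history X n `<=` measurable.
Proof. exact: history_measurable. Qed.

Lemma chain_step n A (f : S -> \bar R) : history X n A ->
  measurable_fun setT f -> (forall y, 0 <= f y) ->
  \int[M]_(w in A) f (X n.+1 w) = \int[M]_(w in A) \int[K (X n w)]_y f y.
Proof.
move=> HA mf f0; apply: integral_disintegration => //; first exact: mhist HA.
by move=> B mB; have [_ _ _] := chain; apply.
Qed.

Lemma chain_init (f : S -> \bar R) :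
  measurable_fun setT f -> (forall y, 0 <= f y) ->
  \int[M]_w f (X 0%N w) = f x0.
Proof.
move=> mf f0; rewrite -(integral_restr_law M measurableT (mX 0))//.
have := @integral_dirac _ S x0 R setT measurableT f mf.
rewrite diracT mul1e => <-.
apply: eq_measure_integral => B mB _.
transitivity (M (X 0%N @^-1` B)); last by have [_ _ + _] := chain; apply.
by rewrite -[X in M X]setTI; exact: restr_lawE.
Qed.

Lemma chain_carrier n (N : set S) : measurable N -> N `&` D = set0 ->
  M (X n @^-1` N) = 0.
Proof.
move=> mN ND; have [_ /(_ n) [Z [mZ Z0 DZ]] _ _] := chain.
apply: (subset_measure0 _ mZ _ Z0).
  by rewrite -[_ @^-1` _]setTI; exact: mX.
by move=> w Nw; apply: DZ => Dw; have : set0 (X n w) by rewrite -ND.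
Qed.

(** The probability, for a chain with kernel [K] started at [x], that the states
    at times [0, ..., k] are in [B 0, ..., B k], as an iterated integral. *)
Fixpoint cylinder_prob (k : nat) (B : nat -> set S) (x : S) : \bar R :=
  ((fun x => if k is k'.+1 then
    \int[K x]_y cylinder_prob k' (fun i => B i.+1) y else 1) \_ (B 0%N)) x.

Lemma cylinder_prob_ge0 k B x : 0 <= cylinder_prob k B x.
Proof.
elim: k B x => [|k IHk] B x /=; apply: erestrict_ge0 => // y _.
exact: integral_ge0.
Qed.

Lemma measurable_cylinder_prob k B : (forall i, measurable (B i)) ->
  measurable_fun setT (cylinder_prob k B).
Proof.
elim: k B => [|k IHk] B mB; apply/(measurable_restrictT _ (mB 0%N)).1 => //.
apply: measurable_funTS.
apply: measurable_fun_integral_kernel => [U mU|y|]; last exact: IHk.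
- exact: measurable_kernel.
- exact: cylinder_prob_ge0.
Qed.

(** Induction on the length: the event [X_n \in B 0] is moved into the history
    and the chain takes one step. *)
Lemma chain_cylinder k n A B : history X n A -> (forall i, measurable (B i)) ->
  M (A `&` cylinder (fun i => X (n + i)%N) k B) =
  \int[M]_(w in A) cylinder_prob k B (X n w).
Proof.
elim: k n A B => [|k IHk] n A B HA mB.
  rewrite -integral_setI_preimage integral_cst ?mul1e.
    congr (M (A `&` _)); apply/seteqP; split=> [w /(_ 0%N isT)|w Bw i].
      by rewrite addn0.
    by rewrite leqn0 => /eqP->; rewrite addn0.
  apply: measurableI; first exact: mhist HA.
  by rewrite -[_ @^-1` _]setTI; exact: mX.
have HAB : history X n (A `&` X n @^-1` B 0%N).
  rewrite history_measE; apply: measurableI; first exact: HA.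
  by rewrite -[_ @^-1` _]setTI; exact: (@measurable_hist_fun _ _ _ _ X n n).
rewrite -integral_setI_preimage -chain_step//; last 2 first.
- exact: measurable_cylinder_prob.
- exact: cylinder_prob_ge0.
rewrite -IHk//; last exact: history_le HAB.
rewrite -setIA; congr (M (A `&` _)).
apply/seteqP; split=> [w Bw|w [Bw0 Bw] [_|i]].
- split; first by have := Bw 0%N isT; rewrite addn0.
  by move=> i ik; have := Bw i.+1 ik; rewrite addnS addSn.
- by rewrite addn0.
- by move=> ik; have := Bw i ik; rewrite addnS addSn.
Qed.

End chain.

Section density.
Context d (S : measurableType d) (R : realType) (P : R.-pker S ~> S) (h : S -> R).
Hypotheses (mh : measurable_fun setT h) (h_ge0 : forall x, (0 <= h x)%R).
Hypotheses (h_harmonic : harmonic_wrt P h) (x0 : S).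
Context d1 (Omega1 : measurableType d1) (M1 : probability Omega1 R).
Context d2 (Omega2 : measurableType d2) (M2 : probability Omega2 R).
Variables (D1 D2 : set S) (X1 : nat -> Omega1 -> S) (X2 : nat -> Omega2 -> S).
Hypothesis chain1 : markov_chain M1 D1 (fun x A => P x A) x0 X1.
Hypothesis chain2 : markov_chain M2 D2 (htransform P h) x0 X2.

(** The density of the [h]-transformed chain on the history up to time [k].  In
    the inductive step the factor [h(X_k)] turns the integral against
    [P^h(X_k, .)] into an integral against [P(X_k, .)] weighted by the height of
    the next state, so the weights telescope. *)
Lemma integral_cylinder_htransform k B (f : S -> \bar R) :
  (forall i, measurable (B i)) -> measurable_fun setT f ->
  (forall x, 0 <= f x) ->
  (h x0)%:E * \int[M2]_(w in cylinder X2 k B) f (X2 k w) =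
  \int[M1]_(w in cylinder X1 k B) (f (X1 k w) * (h (X1 k w))%:E).
Proof.
pose Q := htransform_kernel mh h_ge0 h_harmonic.
have chainQ : markov_chain M2 D2 (fun x A => Q x A) x0 X2 by [].
move=> mB; elim: k f => [|k IHk] f mf f0.
- have mfh : measurable_fun setT (fun y => f y * (h y)%:E).
    by apply: emeasurable_funM => //; apply/measurable_EFinP.
  have E0 Omega (X : nat -> Omega -> S) :
      cylinder X 0 B = setT `&` X 0%N @^-1` B 0%N.
    rewrite setTI; apply/seteqP; split=> [w /(_ 0%N isT)//|w Bw i].
    by rewrite leqn0 => /eqP->.
  rewrite !E0 integral_setI_preimage.
  rewrite (integral_setI_preimage M1 setT (X1 0) (B 0%N)
    (fun x => f x * (h x)%:E)).
  rewrite (chain_init chainQ)//; last 2 first.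
  + exact: measurable_patch.
  + by move=> y; apply: erestrict_ge0.
  rewrite (chain_init chain1)//; last 2 first.
  + exact: measurable_patch.
  + by move=> y; apply: erestrict_ge0 => z _; rewrite mule_ge0// lee_fin.
  by rewrite !patchE; case: ifPn => _; rewrite ?mule0// muleC.
- rewrite !cylinderS integral_setI_preimage.
  rewrite (integral_setI_preimage M1 _ (X1 k.+1) _ (fun x => f x * (h x)%:E)).
  have mfB : measurable_fun setT (f \_ (B k.+1)).
    exact: measurable_patch.
  have fB0 y : 0 <= (f \_ (B k.+1)) y by apply: erestrict_ge0.
  have HE dO (Omega : measurableType dO) (X : nat -> Omega -> S) :
      cylinders X k (cylinder X k B) by exists B.
  have fhE : (fun x => f x * (h x)%:E) \_ (B k.+1) =
      (fun x => (f \_ (B k.+1)) x * (h x)%:E).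
    by apply/funext => y; rewrite !patchE; case: ifPn => // _; rewrite mul0e.
  rewrite fhE (chain_step chainQ (history_cylinder (HE _ _ _)))//.
  rewrite (@chain_step _ _ _ _ _ _ _ P _ _ chain1 _ _
    (fun x => (f \_ (B k.+1)) x * (h x)%:E)
    (history_cylinder (HE _ _ _))); last 2 first.
  + by apply: emeasurable_funM => //; apply/measurable_EFinP.
  + by move=> y; rewrite mule_ge0// lee_fin.
  rewrite (IHk (fun x => \int[Q x]_y (f \_ (B k.+1)) y)); last 2 first.
  + apply: measurable_fun_integral_kernel => // U mU.
    exact: (measurable_kernel Q).
  + by move=> x; exact: integral_ge0.
  by apply: eq_integral => w _; rewrite muleC integral_htransform.
Qed.

End density.

(** * The random level *)

Lemma uniform_prob_le (R : realType) (b t : R) (b0 : (0 < b)%R) :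
  (0 <= t <= b)%R -> uniform_prob b0 [set u | (u <= t)%R] = (t / b)%:E.
Proof.
move=> /andP[t0 tb]; rewrite /uniform_prob integral_uniform_pdf.
have -> : [set u | (u <= t)%R] `&` `[0%R, b] = `[0%R, t]%classic.
  apply/seteqP; split=> u /=; rewrite !in_itv/=.
    by move=> [-> /andP[-> _]].
  by move=> /andP[-> ut]; rewrite ut (le_trans ut).
rewrite (eq_integral (fun=> b^-1%:E)); last first.
  move=> u; rewrite inE/= in_itv/= => /andP[u0 ut].
  by rewrite /uniform_pdf u0 (le_trans ut tb)/= subr0.
rewrite integral_cst//= lebesgue_measure_itv/= lte_fin.
have [_|t0'] := ltP 0%R t; first by rewrite sube0 -EFinM mulrC.
by rewrite (@le_anti _ _ t 0%R) ?t0 ?t0'// mul0r mule0.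
Qed.

Lemma mule_pos_inj (R : realType) (c : R) : (0 < c)%R -> injective ( *%E c%:E).
Proof.
move=> c0 x y cxy; apply/le_anti.
have cle := @lee_pmul2l R c%:E isT; rewrite -(cle _ x y) ?lte_fin//.
by rewrite -(cle _ y x) ?lte_fin// cxy lexx.
Qed.

Section uniform_level.
Context d (S : measurableType d) (R : realType).
Context dO (Omega : measurableType dO) (Pr : probability Omega R).
Variables (X : nat -> Omega -> S) (U : {RV Pr >-> R}) (b : R) (b0 : (0 < b)%R).
Hypothesis mX : forall n, measurable_fun setT (X n).
Hypothesis U_uniform : forall A : set R, measurable A ->
  distribution Pr U A = uniform_prob b0 A.
Hypothesis XU_indep : independent_rv Pr (trajectory X) U.

Let mY : measurable_fun setT (trajectory X).
Proof. exact: measurable_trajectory. Qed.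

Lemma measurable_trajectory_pair :
  measurable_fun setT (fun w => (trajectory X w, U w : R)).
Proof. exact: measurable_fun_pair. Qed.

(** A uniform level on [(0, b)] that is independent of the path is below the
    height [g] with conditional probability [g / b]. *)
Lemma independent_uniform_le (A : set (paths S)) (g : paths S -> R) :
  measurable A -> measurable_fun setT g ->
  (forall w, A w -> 0 <= g w <= b)%R ->
  b%:E * Pr (trajectory X @^-1` A `&` [set w | (U w <= g (trajectory X w))%R]) =
  \int[Pr]_(w in trajectory X @^-1` A) (g (trajectory X w))%:E.
Proof.
move=> mA mg gA.
pose C := [set z : paths S * R | A z.1 /\ (z.2 <= g z.1)%R].
have mC : measurable C.
  rewrite [C](_ : _ = (fst @^-1` A) `&` [set z | (z.2 <= g z.1)%R])//.
  apply: measurableI; first by rewrite -[_ @^-1` _]setTI; exact: measurable_fst.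
  rewrite -[X in measurable X]setTI.
  by apply: measurable_fun_ler => //; exact: measurableT_comp.
have -> : trajectory X @^-1` A `&` [set w | (U w <= g (trajectory X w))%R] =
    setT `&` (fun w => (trajectory X w, U w : R)) @^-1` C by rewrite setTI.
pose m1 : giry (paths S) R := restr_law Pr measurableT mY.
pose m2 : probability R R := distribution Pr U.
have -> : Pr (setT `&` (fun w => (trajectory X w, U w : R)) @^-1` C) =
    (m1 \x m2) C.
  rewrite -(restr_lawE Pr measurableT measurable_trajectory_pair).
  apply/esym/product_measure_unique => // A' B' mA' mB'.
  transitivity (Pr (trajectory X @^-1` A' `&` (U : Omega -> R) @^-1` B')).
    rewrite -[in RHS](setTI (_ `&` _)); exact: restr_lawE.
  rewrite XU_indep//; congr (_ * _).
  by rewrite -[in LHS](setTI (_ @^-1` _)); exact/esym/restr_lawE.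
rewrite /product_measure1 /=.
have m2E w : m2 (xsection C w) = ((fun w => (g w / b)%:E) \_ A) w.
  rewrite patchE; case: ifPn => [|/negP]; rewrite in_setE => Aw.
    rewrite -(uniform_prob_le b0 (gA w Aw)) -U_uniform.
      congr (distribution Pr U _); apply/seteqP; split=> u.
        by rewrite /xsection/= in_setE => -[].
      by rewrite /xsection/= in_setE => ?; split.
    rewrite -[X in measurable X]setTI; exact: measurable_fun_ler.
  rewrite (_ : xsection C w = set0) ?measure0//.
  by apply/seteqP; split=> // u; rewrite /xsection/= in_setE => -[].
under eq_integral do rewrite m2E.
have mgb : measurable_fun setT ((fun w => (g w / b)%:E) \_ A).
  apply: measurable_patch => //.
  by apply/measurable_EFinP; exact: measurable_funM.
have gb0 w : 0 <= ((fun w => (g w / b)%:E) \_ A) w.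
  apply: erestrict_ge0 => v Av; rewrite lee_fin divr_ge0//; last exact: ltW.
  by have /andP[] := gA _ Av.
rewrite integral_restr_law// -ge0_integralZl//; last 2 first.
- exact: measurableT_comp.
- by rewrite lee_fin ltW.
rewrite [RHS]integral_mkcond; apply: eq_integral => w _.
rewrite !patchE; have -> : (w \in trajectory X @^-1` A) = (trajectory X w \in A).
  by [].
case: ifPn => _; last by rewrite mule0.
by rewrite -EFinM mulrCA divff ?mulr1// gt_eqF.
Qed.

End uniform_level.

Section level_law.
Context d (S : measurableType d) (R : realType) (P : R.-pker S ~> S) (h : S -> R).
Hypotheses (mh : measurable_fun setT h) (h_ge0 : forall x, (0 <= h x)%R).
Hypotheses (h_harmonic : harmonic_wrt P h) (o : S) (ho : (0 < h o)%R).
Context dO (Omega : measurableType dO) (Pr : probability Omega R).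
Variables (X : nat -> Omega -> S) (U : {RV Pr >-> R}).
Variables (D DQ : set S) (Q : probability (paths S) R).
Hypothesis X_chain : markov_chain Pr D (fun x A => P x A) o X.
Hypothesis Q_chain : markov_chain Q DQ (htransform P h) o (@coordinate d S).
Hypothesis U_uniform : forall A : set R, measurable A ->
  distribution Pr U A = uniform_prob ho A.
Hypothesis XU_indep : independent_rv Pr (trajectory X) U.
Local Notation coord := (@coordinate d S).

Let mX n : measurable_fun setT (X n).
Proof. by have [mX _ _ _] := X_chain. Qed.

Let mY : measurable_fun setT (trajectory X).
Proof. exact: measurable_trajectory. Qed.

Let mhX n : measurable_fun setT (fun w => h (X n w)).
Proof. exact: measurableT_comp. Qed.

Let mhc n : measurable_fun setT (fun w => h (coord n w)).
Proof. by apply: measurableT_comp => //; exact: measurable_coordinate. Qed.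

Let mneq : measurable [set x | h x <> h o].
Proof.
rewrite -[X in measurable X]setTI.
exact: (mh measurableT (measurableC (measurable_set1 (h o)))).
Qed.

Lemma htransform_initial_level : Q [set w | h (coord 0 w) <> h o] = 0.
Proof.
have [_ _ /(_ _ mneq) + _] := Q_chain.
by rewrite diracE memNset//= => /(_ erefl).
Qed.

Lemma initial_level : Pr [set w | h (X 0%N w) <> h o] = 0.
Proof.
have [_ _ /(_ _ mneq) + _] := X_chain.
by rewrite diracE memNset//= => /(_ erefl).
Qed.

Let mle n : measurable [set w : paths S | (h (coord n w) <= h o)%R].
Proof. by rewrite -[X in measurable X]setTI; exact: measurable_fun_ler. Qed.

Let mXle n : measurable (trajectory X @^-1` [set w | (h (coord n w) <= h o)%R]).
Proof. by rewrite -[X in measurable X]setTI; exact: mY. Qed.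

Let mUle n : measurable [set w | (U w <= h (X n w))%R].
Proof. by rewrite -[X in measurable X]setTI; exact: measurable_fun_ler. Qed.

Let cylinder_trajectory k B :
  cylinder X k B = trajectory X @^-1` cylinder coord k B.
Proof. by []. Qed.

(** The density formula for a constant function, read through
    [independent_uniform_le]. *)
Let level_law_cylinder k B : (forall i, measurable (B i)) ->
  (forall x, B k x -> h x <= h o)%R ->
  Pr (cylinder X k B `&` [set w | (U w <= h (X k w))%R]) = Q (cylinder coord k B).
Proof.
move=> mB Bk.
have mC : measurable (cylinder coord k B).
  apply: (@history_measurable _ (paths S) _ S coord k).
    exact: measurable_coordinate.
  by apply: history_cylinder; exists B.
have ck w : cylinder coord k B w -> (h (coord k w) <= h o)%R.
  by move=> Bw; apply: Bk; exact: Bw.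
apply: (mule_pos_inj ho).
rewrite cylinder_trajectory.
rewrite (@independent_uniform_le _ S _ _ _ _ _ U _ ho mX U_uniform XU_indep
  (cylinder coord k B) (fun w => h (coord k w)) mC (mhc k)); last first.
  by move=> w Bw; rewrite h_ge0/= ck.
transitivity ((h o)%:E * \int[Q]_(w in cylinder coord k B) 1).
  rewrite (integral_cylinder_htransform mh h_ge0 h_harmonic X_chain Q_chain
    k (f := cst 1))//.
  by apply: eq_integral => w _; rewrite /= mul1e.
by rewrite integral_cst// mul1e.
Qed.

(** The uniform level realises the density of the [h]-transform: given the
    history up to [k], the event [U <= h(X_k)] has conditional probability
    [h(X_k) / h(o)].  The condition on [A] keeps this ratio at most one,
    as [h(X_0) = h(o)] almost surely. *)
Lemma level_law k A : history coord k A ->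
  A `<=` [set w | (h (coord k w) <= h (coord 0 w))%R] ->
  Pr (trajectory X @^-1` A `&` [set w | (U w <= h (X k w))%R]) = Q A.
Proof.
move=> HA Ak.
have mA : measurable A.
  by apply: history_measurable HA; exact: measurable_coordinate.
have mUk : measurable ([set w | (U w <= h (X k w))%R] `&`
    trajectory X @^-1` [set w | (h (coord k w) <= h o)%R]).
  exact: measurableI.
have agree B : history coord k B ->
    restr_law Pr mUk mY B = mrestr Q (mle k) B.
  move=> /history_sub_cylinders; apply: (@eq_measure_pi_system _ (paths S)).
  - move=> C /history_cylinder; apply: history_measurable.
    exact: measurable_coordinate.
  - exact: cylindersI.
  - exact: cylindersT.
  - by rewrite (le_lt_trans sprobability_setT)// ltry.
  move=> _ [C mC ->].
  pose C' i := if i == k then C i `&` [set x | (h x <= h o)%R] else C i.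
  have mC' i : measurable (C' i).
    rewrite /C'; case: ifP => // _; apply: measurableI => //.
    by rewrite -[X in measurable X]setTI; exact: measurable_fun_ler.
  have C'E : cylinder coord k C `&` [set w | (h (coord k w) <= h o)%R] =
      cylinder coord k C'.
    apply/seteqP; split=> [w [Cw hw] i ik|w Cw].
      by rewrite /C'; case: eqP => [->|_]; [split=> //|]; exact: Cw.
    split=> [i ik|]; last by have := Cw k (leqnn k); rewrite /C' eqxx => -[].
    by have := Cw i ik; rewrite /C'; case: eqP => // _ [].
  transitivity (Q (cylinder coord k C')); last by rewrite -C'E.
  (* [C'] is the cylinder [C] with its last set cut down to [{h <= h o}]. *)
  rewrite -level_law_cylinder//; last by move=> x; rewrite /C' eqxx => -[].
  rewrite cylinder_trajectory -C'E.
  transitivity (Pr (([set w | (U w <= h (X k w))%R] `&`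
    trajectory X @^-1` [set w | (h (coord k w) <= h o)%R]) `&`
    trajectory X @^-1` cylinder coord k C)); first exact: restr_lawE.
  congr (Pr _); rewrite preimage_setI setIC -setIA; congr (_ `&` _).
  by rewrite setIC.
have mUA : measurable (trajectory X @^-1` A `&` [set w | (U w <= h (X k w))%R]).
  by apply: measurableI => //; rewrite -[X in measurable X]setTI; exact: mY.
transitivity (mrestr Q (mle k) A).
  rewrite -agree// (restr_lawE Pr mUk mY A).
  apply: (@eq_measure_null _ _ _ _ [set w | h (X 0%N w) <> h o]) => //.
  - by rewrite -[X in measurable X]setTI; exact: (mX 0 measurableT mneq).
  - by apply: measurableI => //; rewrite -[X in measurable X]setTI; exact: mY.
  - exact: initial_level.
  move=> w /contrapT h0; split=> [[Aw Uw]|[[Uw _] Aw]]//.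
  by split=> //; split=> //=; rewrite -h0; exact: Ak Aw.
apply: (@eq_measure_null _ _ _ Q [set w | h (coord 0 w) <> h o]) => //.
- rewrite -[X in measurable X]setTI.
  exact: (measurable_coordinate 0 measurableT mneq).
- exact: measurableI.
- exact: htransform_initial_level.
move=> w /contrapT h0; split=> [[]//|Aw].
by split=> //=; rewrite -h0; exact: Ak Aw.
Qed.



End level_law.

(** * The kernel of path laws and the Markov property *)

Section path_kernel.
Context d (S : measurableType d) (R : realType) (P : R.-pker S ~> S) (h : S -> R).
Variable Ph : S -> probability (paths S) R.
Local Notation coord := (@coordinate d S).
Local Notation Ph_chain_hyp := (forall x, positivity_set h x ->
  markov_chain (Ph x) (positivity_set h) (htransform P h) x coord).

(** The laws [P^h_x] for [h x > 0], extended by zero: the values of [Ph] outside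
    the positivity set of [h] carry no information.  The assumptions are
    arguments because they make this family a kernel. *)
Definition path_kernel of measurable_fun setT h & (forall x, 0 <= h x)%R
    & harmonic_wrt P h & Ph_chain_hyp :
    S -> {measure set (paths S) -> \bar R} :=
  fun x => if (0 < h x)%R then (Ph x : {measure set (paths S) -> \bar R})
    else mzero.

Hypotheses (mh : measurable_fun setT h) (h_ge0 : forall x, (0 <= h x)%R).
Hypotheses (h_harmonic : harmonic_wrt P h) (Ph_chain : Ph_chain_hyp).
Let Q := htransform_kernel mh h_ge0 h_harmonic.
Local Notation K := (path_kernel mh h_ge0 h_harmonic Ph_chain).

Let mpos : measurable (positivity_set h).
Proof.
by rewrite -[X in measurable X]setTI; exact: measurable_fun_ltr.
Qed.

Let path_kernel_cylinder k B x : (forall i, measurable (B i)) ->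
  K x (cylinder coord k B) = (cylinder_prob Q k B \_ (positivity_set h)) x.
Proof.
move=> mB; rewrite /path_kernel patchE; case: ifPn => [hx|hx].
  rewrite mem_set//; have chain := Ph_chain hx.
  have chainQ : markov_chain (Ph x) (positivity_set h) (fun x A => Q x A) x coord.
    exact: chain.
  rewrite -(chain_init chainQ (measurable_cylinder_prob Q k mB)
    (cylinder_prob_ge0 Q k B)).
  rewrite -(chain_cylinder chainQ k (n := 0))// ?setTI//.
  exact: (@measurableT _ (hist_type coord 0)).
by rewrite memNset// => hx'; rewrite hx' in hx.
Qed.

Let path_kernel_le1 x : K x setT <= 1.
Proof.
rewrite /path_kernel; case: ifP => // _; exact: sprobability_setT.
Qed.

Let measurable_path_kernel A :
  measurable A -> measurable_fun setT (K ^~ A).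
Proof.
move=> mA; apply: (measurable_kernel_pi_system (@all_cylinders_measurable _ S)
  (@all_cylindersI _ S) (@all_cylindersT _ S)).
- by move=> x; rewrite (le_lt_trans (path_kernel_le1 x))// ltry.
- move=> _ [k _ [B mB ->]].
  rewrite [X in measurable_fun _ X](_ : _ =
    cylinder_prob Q k B \_ (positivity_set h)).
    by apply: measurable_patch => //; exact: measurable_cylinder_prob.
  by apply/funext => x; exact: path_kernel_cylinder.
- exact: measurable_sub_all_cylinders.
Qed.

HB.instance Definition _ := isKernel.Build _ _ _ _ _ K measurable_path_kernel.

Let path_kernel_sprob : ereal_sup [set K x setT | x in setT] <= 1.
Proof.
by apply/(sprob_kernelP (fun x A => K x A)) => x; exact: path_kernel_le1.
Qed.

HB.instance Definition _ := Kernel_isSubProbability.Build _ _ _ _ _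
  K path_kernel_sprob.

Definition path_spker : R.-spker S ~> paths S := K.

Lemma path_kernelE x A : (0 < h x)%R -> path_spker x A = Ph x A.
Proof. by move=> hx; rewrite /path_spker /= /path_kernel hx. Qed.

Lemma path_kernel0 x A : ~ (0 < h x)%R -> path_spker x A = 0.
Proof. by move=> /negP/negbTE hx; rewrite /path_spker /= /path_kernel hx. Qed.

Variables (M : probability (paths S) R) (x0 : S).
Hypothesis chain : markov_chain M (positivity_set h) (htransform P h) x0 coord.

(** Shifted cylinders have the right conditional probabilities by
    [chain_cylinder], and they form a generating pi-system. *)
Lemma markov_property n A B : history coord n A -> measurable B ->
  M (A `&` shift n @^-1` B) = \int[M]_(w in A) path_spker (coord n w) B.
Proof.
move=> HA mB.
have mA : measurable A.
  by apply: history_measurable HA; exact: measurable_coordinate.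
have chainQ : markov_chain M (positivity_set h) (fun x A => Q x A) x0 coord.
  exact: chain.
have mn := @measurable_coordinate _ S n.
apply: (disintegration_pi_system mA mn (measurable_shift n)
  (@all_cylinders_measurable _ S) (@all_cylindersI _ S) (@all_cylindersT _ S)).
- move=> _ [k _ [C mC ->]].
  rewrite (_ : shift n @^-1` _ = cylinder (fun i => coord (n + i)%N) k C)//.
  rewrite (chain_cylinder chainQ k HA mC).
  apply: ge0_ae_eq_integral => //.
  + apply: measurable_funTS.
    exact: (measurableT_comp (measurable_cylinder_prob Q k mC) mn).
  + have mCk : measurable (cylinder coord k C).
      by apply: all_cylinders_measurable; exists k => //; exists C.
    apply: measurable_funTS.
    exact: (measurableT_comp (measurable_kernel path_spker _ mCk) mn).
  + by move=> w _; exact: cylinder_prob_ge0.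
  exists (coord n @^-1` (~` positivity_set h)); split.
  + by rewrite -[X in measurable X]setTI; apply: mn => //; exact: measurableC.
  + apply: (chain_carrier chainQ); first exact: measurableC.
    by rewrite setICl.
  move=> w /= /not_implyP[_ ne] hw; apply: ne.
  by rewrite -[RHS]/(K _ _) path_kernel_cylinder// patchE mem_set.
- exact: measurable_sub_all_cylinders.
Qed.

Lemma integral_markov_property n A (f : paths S -> \bar R) : history coord n A ->
  measurable_fun setT f -> (forall w, 0 <= f w) ->
  \int[M]_(w in A) f (shift n w) =
  \int[M]_(w in A) \int[path_spker (coord n w)]_v f v.
Proof.
move=> HA mf f0; apply: integral_disintegration => //.
- by apply: history_measurable HA; exact: measurable_coordinate.
- exact: measurable_coordinate.
- exact: measurable_shift.
- by move=> B mB; exact: markov_property.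
Qed.

End path_kernel.

(** * Strict records of a sequence of heights *)

Section records.
Variables (R : realType) (f : nat -> R).

Definition strict_record n := forall m, (m < n)%N -> (f n < f m)%R.

Definition below_past k m := forall i, (i <= k)%N -> (f m < f i)%R.

Definition first_passage k m :=
  [/\ (k < m)%N, below_past k m & forall j, (k < j < m)%N -> ~ below_past k j].

Definition no_passage k := forall m, (k < m)%N -> ~ below_past k m.

Lemma first_passage_uniq k m n :
  first_passage k m -> first_passage k n -> m = n.
Proof.
move=> [km bm nm] [kn bn nn]; apply/eqP; rewrite eqn_leq.
apply/andP; split; rewrite leqNgt; apply/negP => lt.
  by apply: (nm n) => //; rewrite kn.
by apply: (nn m) => //; rewrite km.
Qed.

Lemma first_passage_le k m : (k < m)%N -> below_past k m ->
  exists2 n, first_passage k n & (n <= m)%N.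
Proof.
move=> km bm.
have ex : exists n, (k < n)%N && `[< below_past k n >].
  by exists m; rewrite km; apply/asboolP.
exists (ex_minn ex); case: ex_minnP => n /andP[kn /asboolP bn] nmin.
  split=> // j /andP[kj jn] bj; move: jn; apply/negP; rewrite -leqNgt.
  by apply: nmin; rewrite kj; apply/asboolP.
by apply: nmin; rewrite km; apply/asboolP.
Qed.

Lemma first_passage_record k m : first_passage k m -> strict_record m.
Proof.
move=> [km bm nm] j jm; have [jk|kj] := leqP j k; first exact: bm.
have := nm j; rewrite kj jm => /(_ isT) /existsNP[i /not_implyP[ik]] /negP.
by rewrite -leNgt; apply: lt_le_trans; exact: bm.
Qed.

Lemma not_no_passage k : ~ no_passage k <-> exists m, first_passage k m.
Proof.
split=> [/existsNP[m /not_implyP[km /contrapT /(first_passage_le km)[n]]]|].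
  by exists n.
by move=> [m [km bm _]] /(_ _ km).
Qed.

(** The minimum over the whole sequence is attained by time [k + 1] if and only
    if it is attained by time [k] or attained first at time [k + 1].  With
    [no_passage_record] this is the recursion along which the laws of the
    spliced process and of the transformed chain are compared. *)
Lemma no_passageS k :
  no_passage k.+1 <->
  no_passage k \/ (strict_record k.+1 /\ no_passage k.+1).
Proof.
split=> [nk|[nk m km bm|[]//]].
  have [rk|nrk] := pselect (strict_record k.+1); first by right.
  left=> m; rewrite leq_eqVlt => /predU1P[<- bm|km bm].
    by apply: nrk => i; exact: bm.
  apply: (nk m km) => i; rewrite leq_eqVlt => /predU1P[->|]; last exact: bm.
  have /existsNP[j /not_implyP[jk /negP]] := nrk.
  by rewrite -leNgt; apply: lt_le_trans; exact: bm.
by apply: (nk m (ltnW km)) => i ik; apply: bm; exact: leqW.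
Qed.

Lemma no_passage_record k : no_passage k -> ~ strict_record k.+1.
Proof. by move=> nk rk; apply: (nk _ (ltnSn k)) => i; exact: rk. Qed.

Lemma no_passage_stay n :
  strict_record n -> no_passage n <-> (forall i, (f n <= f (n + i)%N)%R).
Proof.
move=> rn; split=> [nn i|le m nm /(_ n (leqnn n))]; last first.
  by apply/negP; rewrite -leNgt -(subnKC (ltnW nm)).
have [->|i0] := posnP i; first by rewrite addn0.
rewrite leNgt; apply/negP => lt; apply: (nn (n + i)%N).
  by rewrite -[ltnLHS]addn0 ltn_add2l.
move=> j; rewrite leq_eqVlt => /predU1P[->//|/rn]; exact: lt_trans.
Qed.

Variable u : R.

Local Notation T := (last_record f u).

Lemma lt_last_record n : (n%:R%:E < T) <->
  exists2 m, (n < m)%N & forall i, (i < m)%N -> (u <= f m < f i)%R.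
Proof.
split=> [/ereal_sup_gt[_ [m mrec <-]]|[m nm mrec]].
  by rewrite lte_fin ltr_nat => nm; exists m.
apply: (@lt_le_trans _ _ m%:R%:E); first by rewrite lte_fin ltr_nat.
by apply: ereal_sup_ubound; exists m.
Qed.

(** If a record above the level [u] occurs after [n], then the first passage
    after [n] is no later, hence no lower, and is itself such a record. *)
Lemma lt_last_record_first_passage n : (n%:R%:E < T) <->
  exists2 m, first_passage n m & (u <= f m)%R.
Proof.
split=> [/lt_last_record[m nm mrec]|[m fpm um]].
  have [k fpk km] : exists2 k, first_passage n k & (k <= m)%N.
    apply: first_passage_le => // i ile.
    by have /andP[] := mrec i (leq_ltn_trans ile nm).
  exists k => //; have : (u <= f m)%R.
    by have /andP[] := mrec n nm.
  move: km; rewrite leq_eqVlt => /predU1P[->//|km um].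
  by have /andP[_ /ltW] := mrec k km; exact: le_trans.
apply/lt_last_record; exists m; first by have [] := fpm.
by move=> i im; rewrite um (first_passage_record fpm).
Qed.

Lemma last_record_ge0 : 0 <= T.
Proof. by apply: ereal_sup_ubound; exists 0%N. Qed.

(** At [n = 0] the first condition is empty: time [0] counts as a record even if
    the level [u] exceeds the initial value. *)
Lemma last_record_nat n : T = n%:R%:E <->
  (forall i, (i < n)%N -> (u <= f n < f i)%R) /\ ~ (n%:R%:E < T).
Proof.
split=> [Tn|[nrec /negP nT]]; last first.
  apply/le_anti; rewrite leNgt nT/=.
  by apply: ereal_sup_ubound; exists n.
split; last by rewrite Tn ltxx.
case: n => [//|n] in Tn *.
have /lt_last_record[m nm mrec] : n%:R%:E < T by rewrite Tn lte_fin ltr_nat.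
suff -> : n.+1 = m by [].
apply/eqP; rewrite eqn_leq nm/= -(@ler_nat R) -lee_fin -Tn.
by apply: ereal_sup_ubound; exists m.
Qed.

Lemma last_record0 : ~ (0%R < T) <-> T = 0%R.
Proof.
split=> [nT|->]; last by rewrite ltxx.
by apply/(last_record_nat 0).
Qed.

(** The counterpart of [no_passageS] for the last record time. *)
Lemma last_recordS n :
  ~ (n.+1%:R%:E < T) <-> ~ (n%:R%:E < T) \/ T = n.+1%:R%:E.
Proof.
split=> [nT|[nT lt|->]]; last by rewrite ltxx.
  have [Tn|Tn] := pselect (n%:R%:E < T); last by left.
  right; apply/last_record_nat; split=> //.
  have /lt_last_record[m nm mrec] := Tn.
  suff -> : n.+1 = m by [].
  apply/eqP; rewrite eqn_leq nm/= leqNgt; apply/negP => lt.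
  by apply: nT; apply/lt_last_record; exists m.
by apply: nT; apply: lt_trans lt; rewrite lte_fin ltr_nat.
Qed.

Lemma last_record_ltey : (T < +oo) -> exists n, T = n%:R%:E.
Proof.
have := last_record_ge0; case ET : T => [r| |]// _ _.
have [n rn] : exists n : nat, (r <= n%:R)%R.
  by exists (Num.truncn r).+1; apply: ltW; exact: truncnS_gt.
have : ~ (n%:R%:E < T) by rewrite ET lte_fin; apply/negP; rewrite -leNgt.
elim: n {rn} => [/last_record0 T0|n IHn /last_recordS[/IHn//|Tn]].
  by exists 0%N; rewrite -ET T0.
by exists n.+1; rewrite -ET.
Qed.

Lemma time_index_nat n : time_index (n%:R%:E : \bar R) = n.
Proof. by rewrite /time_index/= natrK. Qed.

End records.

(** * Record events on the path space *)

Section record_events.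
Context d (S : measurableType d) (R : realType) (h : S -> R).
Hypothesis mh : measurable_fun setT h.
Local Notation coord := (@coordinate d S).

Definition height (w : paths S) : nat -> R := fun n => h (coord n w).

Definition record_at n : set (paths S) := [set w | strict_record (height w) n].

Definition passage_at k m : set (paths S) :=
  [set w | first_passage (height w) k m].

Definition never_passes k : set (paths S) := [set w | no_passage (height w) k].

Lemma measurable_hist_height n i : (i <= n)%N ->
  measurable_fun setT (fun w : hist_type coord n => height w i).
Proof.
by move=> ilen; apply: measurableT_comp => //; exact: measurable_hist_fun.
Qed.

Lemma measurable_height i : measurable_fun setT (height ^~ i).
Proof. by apply: measurableT_comp => //; exact: measurable_coordinate. Qed.

Lemma history_height_lt n i j : (i <= n)%N -> (j <= n)%N ->
  history coord n [set w | (height w i < height w j)%R].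
Proof.
move=> ilen jlen; rewrite history_measE -[X in measurable X]setTI.
by apply: measurable_fun_ltr => //; exact: measurable_hist_height.
Qed.

Lemma history_record_at n : history coord n (record_at n).
Proof.
rewrite history_measE (_ : record_at n = \bigcap_(i in [set i | (i < n)%N])
  [set w | (height w n < height w i)%R])//.
apply: bigcap_measurableType => i /= iltn.
by apply: history_height_lt => //; exact: ltnW.
Qed.

Lemma history_below_past n k m : (k <= n)%N -> (m <= n)%N ->
  history coord n [set w | below_past (height w) k m].
Proof.
move=> kn mn; rewrite history_measE.
rewrite (_ : mkset _ = \bigcap_(i in [set i | (i <= k)%N])
  [set w | (height w m < height w i)%R])//.
apply: bigcap_measurableType => i /= ik.
by apply: history_height_lt => //; exact: leq_trans kn.
Qed.

Lemma history_passage_at k m : history coord m (passage_at k m).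
Proof.
have [km|mk] := ltnP k m; last first.
  rewrite (_ : passage_at k m = set0); first exact: sigma_algebra0.
  by apply/seteqP; split=> // w [km]; move: mk; rewrite leqNgt km.
rewrite (_ : passage_at k m = [set w | below_past (height w) k m] `&`
  \bigcap_(j in [set j | (k < j < m)%N]) ~` [set w | below_past (height w) k j]).
  rewrite history_measE; apply: measurableI.
    by apply: history_below_past => //; exact: ltnW.
  apply: bigcap_measurableType => j /= /andP[kj jm]; apply: measurableC.
  by apply: history_below_past; exact: ltnW.
by apply/seteqP; split=> [w [_ bm nm]|w [bm nm]]; split.
Qed.

Lemma measurable_record_at n : measurable (record_at n).
Proof.
by apply: history_coordinate_measurable; exact: history_record_at.
Qed.

Lemma measurable_passage_at k m : measurable (passage_at k m).
Proof.
by apply: history_coordinate_measurable; exact: history_passage_at.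
Qed.

Lemma never_passesC k : ~` never_passes k = \bigcup_m passage_at k m.
Proof.
apply/seteqP; split=> [w /not_no_passage[m fp]|w [m _ fp]]; first by exists m.
by apply/not_no_passage; exists m.
Qed.

Lemma measurable_never_passes k : measurable (never_passes k).
Proof.
rewrite -[never_passes k]setCK never_passesC; apply: measurableC.
by apply: bigcupT_measurable => m; exact: measurable_passage_at.
Qed.

Definition record_time (z : paths S * R) : \bar R := last_record (height z.1) z.2.

Lemma measurable_level m :
  measurable [set z : paths S * R | (z.2 <= height z.1 m)%R].
Proof.
rewrite -[X in measurable X]setTI; apply: measurable_fun_ler => //.
exact: (measurableT_comp (measurable_height m) measurable_fst).
Qed.

Lemma record_time_gtE n : [set z | n%:R%:E < record_time z] =
  \bigcup_m ((fst @^-1` passage_at n m) `&` [set z | (z.2 <= height z.1 m)%R]).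
Proof.
apply/seteqP; split=> z.
  by move=> /lt_last_record_first_passage[m]; exists m.
by move=> [m _ []]; move=> ? ?; apply/lt_last_record_first_passage; exists m.
Qed.

Lemma measurable_record_time_gt n : measurable [set z | n%:R%:E < record_time z].
Proof.
rewrite record_time_gtE; apply: bigcupT_measurable => m.
apply: measurableI; last exact: measurable_level.
rewrite -[X in measurable X]setTI.
by apply: measurable_fst => //; exact: measurable_passage_at.
Qed.

Lemma measurable_record_time_eq n : measurable [set z | record_time z = n%:R%:E].
Proof.
case: n => [|n].
  rewrite (_ : mkset _ = ~` [set z | 0%:R%:E < record_time z]).
    by apply: measurableC; exact: measurable_record_time_gt.
  by apply/seteqP; split=> z /last_record0.
rewrite (_ : mkset _ = [set z | n%:R%:E < record_time z] `&`
    ~` [set z | n.+1%:R%:E < record_time z]).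
  apply: measurableI; first exact: measurable_record_time_gt.
  by apply: measurableC; exact: measurable_record_time_gt.
apply/seteqP; split=> [z /= zn|z [zn /last_recordS[]//]].
by rewrite /= zn ltxx lte_fin ltr_nat ltnSn.
Qed.

End record_events.

(** * The law of the last record time *)

Section record_laws.
Context d (S : measurableType d) (R : realType) (P : R.-pker S ~> S) (h : S -> R).
Hypotheses (mh : measurable_fun setT h) (h_ge0 : forall x, (0 <= h x)%R).
Hypotheses (h_harmonic : harmonic_wrt P h) (o : S) (ho : (0 < h o)%R).
Context dO (Omega : measurableType dO) (Pr : probability Omega R).
Variables (X : nat -> Omega -> S) (U : {RV Pr >-> R}).
Variables (D DQ : set S) (Q : probability (paths S) R).
Hypothesis X_chain : markov_chain Pr D (fun x A => P x A) o X.
Hypothesis Q_chain : markov_chain Q DQ (htransform P h) o (@coordinate d S).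
Hypothesis U_uniform : forall A : set R, measurable A ->
  distribution Pr U A = uniform_prob ho A.
Hypothesis XU_indep : independent_rv Pr (trajectory X) U.
Local Notation coord := (@coordinate d S).
Local Notation tX := (trajectory X).
Local Notation T := (fun w => last_record (fun n => h (X n w)) (U w)).

Let mX n : measurable_fun setT (X n).
Proof. by have [mX _ _ _] := X_chain. Qed.

Let mtX : measurable_fun setT tX.
Proof. exact: measurable_trajectory. Qed.

Let mtXU : measurable_fun setT (fun w => (tX w, U w : R)).
Proof. exact: measurable_trajectory_pair. Qed.

Let mtXE (A : set (paths S)) : measurable A -> measurable (tX @^-1` A).
Proof. by move=> mA; rewrite -[X in measurable X]setTI; exact: mtX. Qed.

Lemma measurable_last_record_gt n : measurable [set w | n%:R%:E < T w].
Proof.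
have := mtXU measurableT (measurable_record_time_gt mh n).
by rewrite setTI.
Qed.

Lemma measurable_last_record_eq n : measurable [set w | T w = n%:R%:E].
Proof.
have := mtXU measurableT (measurable_record_time_eq mh n).
by rewrite setTI.
Qed.

Let mUle n : measurable [set w | (U w <= h (X n w))%R].
Proof.
rewrite -[X in measurable X]setTI; apply: measurable_fun_ler => //.
exact: measurableT_comp.
Qed.

(** Off this null event the level is positive and at most the initial height, so
    every record counted by the last record time is above the level. *)
Definition exceptional : set Omega :=
  ~` [set w | (U w <= h (X 0%N w))%R] `|` [set w | (U w <= 0)%R].

Let mU0 : measurable [set w | (U w <= 0)%R].
Proof. by rewrite -[X in measurable X]setTI; exact: measurable_fun_ler. Qed.

Lemma measurable_exceptional : measurable exceptional.
Proof. by apply: measurableU => //; exact: measurableC. Qed.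

Lemma exceptional_null : Pr exceptional = 0.
Proof.
have U0 : Pr [set w | (U w <= 0)%R] = 0.
  transitivity (distribution Pr U [set u | (u <= 0)%R]) => //.
  rewrite U_uniform; first by rewrite uniform_prob_le ?mul0r// lexx ltW.
  by rewrite -[X in measurable X]setTI; exact: measurable_fun_ler.
have Uh : Pr (~` [set w | (U w <= h (X 0%N w))%R]) = 0.
  rewrite probability_setC// -(setTI [set w | _]) -(preimage_setT tX).
  rewrite (level_law mh h_ge0 h_harmonic X_chain Q_chain U_uniform XU_indep)//.
  - by rewrite probability_setT subee.
  - exact: (@measurableT _ (hist_type coord 0)).
  - by move=> w _ /=.
apply/eqP; rewrite eq_le measure_ge0 andbT.
have := measureU2 Pr (measurableC (mUle 0)) mU0.
by rewrite [X in _ + X](_ : _ = 0)// [X in X + _](_ : _ = 0)// adde0.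
Qed.

(** Decompose according to the first passage [m] after [k] and apply [level_law]
    at each [m]; a first passage is a strict record, hence not higher than the
    initial state. *)
Lemma law_last_record_gt k A : history coord k A ->
  Pr (tX @^-1` A `&` [set w | k%:R%:E < T w]) = Q (A `&` ~` never_passes h k).
Proof.
move=> HA.
have HF m : history coord m (A `&` passage_at h k m).
  have [km|mk] := ltnP k m; last first.
    rewrite (_ : passage_at h k m = set0) ?setI0; first exact: sigma_algebra0.
    by apply/seteqP; split=> // w [km]; move: mk; rewrite leqNgt km.
  rewrite history_measE; apply: measurableI; last exact: history_passage_at.
  exact: history_le (ltnW km) _ HA.
have FE m : Pr (tX @^-1` (A `&` passage_at h k m) `&`
    [set w | (U w <= h (X m w))%R]) = Q (A `&` passage_at h k m).
  apply: (level_law mh h_ge0 h_harmonic X_chain Q_chain U_uniform XU_indep) => //.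
  by move=> w [_ [_ bm _]]; rewrite /= ltW//; exact: (bm 0%N).
have tF : trivIset setT (fun m => A `&` passage_at h k m).
  apply/trivIsetP => i j _ _ /eqP ij; apply/seteqP; split=> // w [[_ fi] [_ fj]].
  by apply: ij; exact: first_passage_uniq fi fj.
rewrite never_passesC setI_bigcupr measure_bigcup//=; last first.
  by move=> m _; exact: history_coordinate_measurable (HF m).
rewrite (_ : _ `&` _ = \bigcup_m (tX @^-1` (A `&` passage_at h k m) `&`
    [set w | (U w <= h (X m w))%R])); last first.
  apply/seteqP; split=> w.
    by move=> [Aw /lt_last_record_first_passage[m fp um]]; exists m.
  move=> [m _ [[Aw fp] um]]; split=> //.
  by apply/lt_last_record_first_passage; exists m.
rewrite measure_bigcup//=.
- by apply: eq_eseriesr => m _; exact: FE.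
- move=> m _; apply: measurableI => //; apply: mtXE.
  exact: history_coordinate_measurable (HF m).
- apply/trivIsetP => i j _ _ ij; apply/seteqP; split=> // w [[fi _] [fj _]].
  move/trivIsetP : tF => /(_ i j Logic.I Logic.I ij) Fij.
  by have : set0 (tX w) by rewrite -Fij.
Qed.

(** At a strict record [n] with [U <= h(X_n)], either the last record time is [n]
    or it is larger.  The union has probability [Q A] by [level_law] and the second
    case is [law_last_record_gt], so the first one follows by subtraction. *)
Lemma law_last_record_eq n A : history coord n A -> A `<=` record_at h n ->
  Pr (tX @^-1` A `&` [set w | T w = n%:R%:E]) = Q (A `&` never_passes h n).
Proof.
move=> HA An; have mA := history_coordinate_measurable HA.
have mN := measurable_never_passes mh n.
have mGt := measurable_last_record_gt n.
have mEq := measurable_last_record_eq n.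
have QA : Q A = Q (A `&` never_passes h n) + Q (A `&` ~` never_passes h n).
  by rewrite (measureDI Q mA mN) setDE addeC.
have PA : Pr (tX @^-1` A `&` [set w | (U w <= h (X n w))%R]) =
    Pr (tX @^-1` A `&` [set w | T w = n%:R%:E]) +
    Pr (tX @^-1` A `&` [set w | n%:R%:E < T w]).
  rewrite -measureU; last 3 first.
  - by apply: measurableI => //; exact: mtXE.
  - by apply: measurableI => //; exact: mtXE.
  - by apply/seteqP; split=> // w [[_ /= ->] [_ /=]]; rewrite ltxx.
  apply: (eq_measure_null measurable_exceptional _ _ exceptional_null).
  - by apply: measurableI => //; exact: mtXE.
  - by apply: measurableU; apply: measurableI => //; exact: mtXE.
  move=> w /not_orP[/contrapT /= U0 _]; split=> [[Aw Uw]|[[Aw /= Tn]|[Aw /= nT]]].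
  - have [nT|nT] := pselect (n%:R%:E < T w); [by right|left; split=> //].
    by apply/last_record_nat; split=> // i /(An _ Aw) hi; rewrite Uw.
  - split=> //=; move/last_record_nat : Tn => [+ _].
    by case: n {HA An mN mGt mEq QA} => // n /(_ 0%N isT) /andP[].
  - split=> //=; move/lt_last_record : nT => [m nm /(_ n nm)].
    by move=> /andP[Um /ltW]; exact: le_trans.
move: PA; rewrite law_last_record_gt//.
rewrite (level_law mh h_ge0 h_harmonic X_chain Q_chain U_uniform XU_indep)//;
  last first.
  move=> w /An; case: n {HA An mN mGt mEq QA} => [|n] rec.
    by rewrite /= lexx.
  by rewrite /= ltW//; exact: (rec 0%N).
rewrite QA => /(congr1 (fun t => t - Q (A `&` ~` never_passes h n))).
have fN : Q (A `&` ~` never_passes h n) \is a fin_num.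
  by apply: fin_num_measure; apply: measurableI => //; exact: measurableC.
by rewrite !addeK.
Qed.

End record_laws.

(** * Conditioning a chain to stay above its initial height *)

Section conditioned_kernel.
Context d (S : measurableType d) (R : realType) (P : R.-pker S ~> S) (h : S -> R).
Hypotheses (mh : measurable_fun setT h) (h_ge0 : forall x, (0 <= h x)%R).
Hypothesis (h_harmonic : harmonic_wrt P h).
Variable Ph : S -> probability (paths S) R.
Local Notation coord := (@coordinate d S).
Hypothesis Ph_chain : forall x, positivity_set h x ->
  markov_chain (Ph x) (positivity_set h) (htransform P h) x coord.
Local Notation K := (path_spker mh h_ge0 h_harmonic Ph_chain).

(** Under [P^h_x] this is almost surely the event of staying above [h x], but it
    does not mention [x], so that it can be shifted along a path. *)
Definition stay_above_start : set (paths S) :=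
  [set w | forall i, (height h w 0 <= height h w i)%R].

Lemma measurable_stay_above_start : measurable stay_above_start.
Proof.
rewrite (_ : stay_above_start = \bigcap_i
  [set w | (height h w 0 <= height h w i)%R]); last first.
  by apply/seteqP; split=> w sw i; [move=> _|]; exact: sw.
apply: bigcapT_measurable => i; rewrite -[X in measurable X]setTI.
by apply: measurable_fun_ler => //; exact: measurable_height.
Qed.

(** The conditional law as a function of the initial state.  If the conditioning
    event is null, both factors vanish, as the inverse of zero is zero. *)
Definition conditioned (B : set (paths S)) (x : S) : \bar R :=
  K x (B `&` stay_above_start) * (fine (K x stay_above_start))^-1%:E.

Lemma conditioned_ge0 B x : 0 <= conditioned B x.
Proof. by rewrite mule_ge0// lee_fin invr_ge0 fine_ge0. Qed.

Lemma measurable_conditioned B : measurable B ->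
  measurable_fun setT (conditioned B).
Proof.
move=> mB; have mK := measurable_kernel K.
apply: emeasurable_funM.
  by apply: mK; apply: measurableI => //; exact: measurable_stay_above_start.
apply/measurable_EFinP; apply: (measurableT_comp (@measurable_inv R)).
apply: measurableT_comp => //.
by apply: mK; exact: measurable_stay_above_start.
Qed.

Lemma path_law_start x (N : set S) : (0 < h x)%R -> measurable N -> ~ N x ->
  Ph x (coord 0 @^-1` N) = 0.
Proof.
move=> hx mN Nx; have [_ _ /(_ _ mN) -> _] := Ph_chain hx.
by rewrite diracE memNset.
Qed.

Lemma cond_prob_stay_above x B : (0 < h x)%R -> measurable B ->
  cond_prob (Ph x) (stay_above h (h x)) B = conditioned B x.
Proof.
move=> hx mB; have mS := measurable_stay_above_start.
have mN : measurable [set y | h y <> h x].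
  rewrite -[X in measurable X]setTI.
  exact: (mh measurableT (measurableC (measurable_set1 (h x)))).
have mA : measurable (stay_above h (h x)).
  rewrite (_ : stay_above h (h x) = \bigcap_i
      [set w | (h x <= height h w i)%R]); last first.
    by apply/seteqP; split=> w sw i; [move=> _|]; exact: sw.
  apply: bigcapT_measurable => i; rewrite -[X in measurable X]setTI.
  by apply: measurable_fun_ler => //; exact: measurable_height.
have E (C : set (paths S)) : measurable C ->
    Ph x (C `&` stay_above h (h x)) = K x (C `&` stay_above_start).
  move=> mC; rewrite path_kernelE//.
  apply: (@eq_measure_null _ _ _ _ (coord 0 @^-1` [set y | h y <> h x])).
  - by rewrite -[X in measurable X]setTI; exact: measurable_coordinate.
  - exact: measurableI.
  - exact: measurableI.
  - by apply: path_law_start => //=; apply.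
  move=> w /contrapT h0; split=> -[Cw sw]; split=> // i.
    by rewrite /height h0; exact: sw.
  by rewrite -h0; exact: sw.
rewrite /cond_prob /conditioned E//; congr (_ * (fine _)^-1%:E).
by rewrite -[stay_above _ _]setTI -[stay_above_start]setTI E.
Qed.

(** The initial state of the path is almost surely [x], so the integrand is a
    constant and the normalisation cancels. *)
Lemma integral_conditioned x B : measurable B ->
  \int[K x]_(w in stay_above_start) conditioned B (coord 0 w) =
  K x (B `&` stay_above_start).
Proof.
move=> mB; have mS := measurable_stay_above_start.
have [hx|hx] := pselect (0 < h x)%R; last first.
  rewrite path_kernel0//.
  rewrite (eq_measure_integral (@mzero _ (paths S) R)) ?integral_measure_zero//.
  by move=> A mA _; rewrite path_kernel0.
transitivity (\int[Ph x]_(w in stay_above_start) conditioned B x).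
  rewrite (eq_measure_integral (Ph x)); last first.
    by move=> A mA _; rewrite path_kernelE.
  have mN : measurable [set y | conditioned B y <> conditioned B x].
    rewrite -[X in measurable X]setTI.
    have m1 := measurableC (emeasurable_set1 (conditioned B x)).
    exact: (measurable_conditioned mB measurableT m1).
  apply: ge0_ae_eq_integral => //.
  - apply: measurable_funTS.
    exact: (measurableT_comp (measurable_conditioned mB)
      (@measurable_coordinate _ S 0)).
  - by move=> w _; exact: conditioned_ge0.
  - by move=> w _; exact: conditioned_ge0.
  exists (coord 0 @^-1` [set y | conditioned B y <> conditioned B x]); split.
  - by rewrite -[X in measurable X]setTI; exact: measurable_coordinate.
  - by apply: path_law_start => //=; apply.
  - by move=> w /= /not_implyP[].
rewrite integral_cst//= /conditioned path_kernelE// path_kernelE//.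
have [p0|p0] := eqVneq (Ph x stay_above_start) 0.
  rewrite [RHS](_ : _ = 0) ?p0 ?mule0//.
  by apply: (subset_measure0 _ mS _ p0) => //; exact: measurableI.
rewrite -muleA -[X in _ * (_ * X)]fineK ?fin_num_measure// -EFinM mulVf ?mule1//.
by rewrite fine_eq0// fin_num_measure.
Qed.

End conditioned_kernel.

(** * The spliced process *)

Section splice_law.
Context d (S : measurableType d) (R : realType) (P : R.-pker S ~> S) (h : S -> R).
Hypotheses (mh : measurable_fun setT h) (h_ge0 : forall x, (0 <= h x)%R).
Hypotheses (h_harmonic : harmonic_wrt P h) (o : S) (ho : (0 < h o)%R).
Variable Ph : S -> probability (paths S) R.
Local Notation coord := (@coordinate d S).
Hypothesis Ph_chain : forall x, positivity_set h x ->
  markov_chain (Ph x) (positivity_set h) (htransform P h) x coord.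
Context dO (Omega : measurableType dO) (Pr : probability Omega R).
Variables (X : nat -> Omega -> S) (U : {RV Pr >-> R}) (D : set S).
Hypothesis X_chain : markov_chain Pr D (fun x A => P x A) o X.
Hypothesis U_uniform : forall A : set R, measurable A ->
  distribution Pr U A = uniform_prob ho A.
Hypothesis XU_indep : independent_rv Pr (trajectory X) U.
Local Notation tX := (trajectory X).
Local Notation T := (fun w => last_record (fun n => h (X n w)) (U w)).
Local Notation XT := (fun w => X (time_index (T w)) w).
Variable Xhat : nat -> Omega -> S.
Hypothesis mXhat : forall n, measurable_fun [set w | T w < +oo] (Xhat n).
Hypothesis Xhat_law : conditional_law_on Pr
  [set w | T w < +oo /\ positivity_set h (XT w)]
  (fun w => (trajectory X w, U w : R)) (trajectory Xhat)
  (fun w => cond_prob (Ph (XT w)) (stay_above h (h (XT w)))).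
Local Notation K := (path_spker mh h_ge0 h_harmonic Ph_chain).
Local Notation Q := (Ph o).

Let Q_chain : markov_chain Q (positivity_set h) (htransform P h) o coord.
Proof. exact: Ph_chain. Qed.

Let mX n : measurable_fun setT (X n).
Proof. by have [mX _ _ _] := X_chain. Qed.

Let mtX : measurable_fun setT tX.
Proof. exact: measurable_trajectory. Qed.

Let mtXE (A : set (paths S)) : measurable A -> measurable (tX @^-1` A).
Proof. by move=> mA; rewrite -[X in measurable X]setTI; exact: mtX. Qed.

Let mGt n : measurable [set w | n%:R%:E < T w].
Proof. exact: (measurable_last_record_gt mh U X_chain). Qed.

Let mEq n : measurable [set w | T w = n%:R%:E].
Proof. exact: (measurable_last_record_eq mh U X_chain). Qed.

Lemma measurable_last_record_ltey : measurable [set w | T w < +oo].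
Proof.
rewrite (_ : mkset _ = \bigcup_n [set w | T w = n%:R%:E]).
  exact: bigcupT_measurable.
apply/seteqP; split=> w; last by move=> [n _ /= ->]; exact: ltry.
by move=> /last_record_ltey[n Tn]; exists n.
Qed.

Let mXhatE n (B : set (paths S)) : measurable B ->
  measurable ([set w | T w = n%:R%:E] `&` trajectory Xhat @^-1` B).
Proof.
move=> mB; rewrite (_ : _ `&` _ = [set w | T w = n%:R%:E] `&`
    ([set w | T w < +oo] `&` trajectory Xhat @^-1` B)).
  apply: measurableI => //.
  by apply: measurable_trajectory => //; exact: measurable_last_record_ltey.
rewrite setIA; congr (_ `&` _); apply/seteqP; split=> [w Tn|w []//].
by split=> //; rewrite /= Tn ltry.
Qed.

(** Path laws are given only from states of positive height.  This event is full
    for the transformed chain, and for [X] at a last record time, because the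
    level is almost surely positive. *)
Definition pos_at n : set (paths S) := [set w | (0 < height h w n)%R].

Lemma history_pos_at n : history coord n (pos_at n).
Proof.
rewrite history_measE -[X in measurable X]setTI.
by apply: measurable_fun_ltr => //; exact: measurable_hist_height.
Qed.

Lemma pos_at_full n : Q (~` pos_at n) = 0.
Proof.
have := chain_carrier (K := htransform_kernel mh h_ge0 h_harmonic) Q_chain n
  (N := ~` positivity_set h).
apply; last by rewrite setICl.
apply: measurableC; rewrite -[X in measurable X]setTI.
exact: measurable_fun_ltr.
Qed.

Let law_last_record_eq_pos n A : history coord n A ->
  A `<=` record_at h n `&` pos_at n -> forall G, measurable G ->
  Pr (tX @^-1` A `&` [set w | T w = n%:R%:E] `&` X n @^-1` G) =
  Q (A `&` never_passes h n `&` coord n @^-1` G).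
Proof.
move=> HA An G mG; rewrite setIAC.
rewrite (_ : _ @^-1` A `&` X n @^-1` G = tX @^-1` (A `&` coord n @^-1` G))//.
rewrite (law_last_record_eq mh h_ge0 h_harmonic X_chain Q_chain U_uniform
  XU_indep).
- by rewrite setIAC.
- rewrite history_measE; apply: measurableI => //.
  rewrite -[X in measurable X]setTI.
  exact: (measurable_hist_fun (leqnn n)).
- by move=> w [/An[]].
Qed.

(** By [law_last_record_eq] the state at which the paths are glued has the same
    law, on the events considered, as the state of the transformed chain at a
    record that is never passed again.  Integrating the conditional law against
    it and using the Markov property at time [n], the normalisation cancels. *)
Let spliced_law_pos n A B : history coord n A ->
  A `<=` record_at h n `&` pos_at n -> measurable B ->
  Pr (tX @^-1` A `&` [set w | T w = n%:R%:E] `&` trajectory Xhat @^-1` B) =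
  Q (A `&` shift n @^-1` (B `&` stay_above_start h)).
Proof.
move=> HA An mB.
have mA := history_coordinate_measurable HA.
have mN := measurable_never_passes mh n.
have mS := measurable_stay_above_start mh.
pose C : set (paths S * R) :=
  (fst @^-1` A) `&` [set z | record_time h z = n%:R%:E].
have mC : measurable C.
  apply: measurableI; last exact: measurable_record_time_eq.
  by rewrite -[X in measurable X]setTI; exact: measurable_fst.
have CE : [set w | T w < +oo /\ positivity_set h (XT w)] `&`
    (fun w => (tX w, U w : R)) @^-1` C =
    tX @^-1` A `&` [set w | T w = n%:R%:E].
  apply/seteqP; split=> w; first by move=> [].
  move=> [Aw /= Tn]; split=> //; rewrite Tn ltry; split=> //.
  by rewrite time_index_nat; have [_] := An _ Aw.
have mD : measurable (tX @^-1` A `&` [set w | T w = n%:R%:E]).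
  by apply: measurableI => //; exact: mtXE.
have mAN : measurable (A `&` never_passes h n) by exact: measurableI.
have mphi := measurable_conditioned mh h_ge0 h_harmonic Ph_chain mB.
have phi0 := conditioned_ge0 mh h_ge0 h_harmonic Ph_chain B.
have mcn := @measurable_coordinate _ S n.
rewrite -CE Xhat_law// CE.
transitivity (\int[Pr]_(w in tX @^-1` A `&` [set w | T w = n%:R%:E])
    conditioned mh h_ge0 h_harmonic Ph_chain B (X n w)).
  apply: eq_integral => w; rewrite in_setE => -[Aw /= Tn].
  rewrite Tn time_index_nat (cond_prob_stay_above mh h_ge0 h_harmonic Ph_chain)//.
  by have [_] := An _ Aw.
transitivity (\int[Q]_(w in A `&` never_passes h n)
    conditioned mh h_ge0 h_harmonic Ph_chain B (coord n w)).
  rewrite -(integral_restr_law Pr mD (mX n))//.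
  rewrite -(integral_restr_law Q mAN mcn)//.
  apply: eq_measure_integral => G mG _.
  transitivity (Pr (tX @^-1` A `&` [set w | T w = n%:R%:E] `&` X n @^-1` G)).
    exact: restr_lawE.
  by rewrite law_last_record_eq_pos//; exact/esym/restr_lawE.
have shE w : coord 0 (shift n w) = coord n w.
  by rewrite /coordinate /shift addn0.
have -> : A `&` never_passes h n = A `&` shift n @^-1` stay_above_start h.
  apply/seteqP; split=> w [Aw].
    move=> /(no_passage_stay (An _ Aw).1) sw; split=> // i.
    by rewrite /height shE; exact: sw.
  move=> sw; split=> //; apply/(no_passage_stay (An _ Aw).1) => i.
  by have := sw i; rewrite /height shE.
transitivity (\int[Q]_(w in A `&` shift n @^-1` stay_above_start h)
    conditioned mh h_ge0 h_harmonic Ph_chain B (coord 0 (shift n w))).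
  by apply: eq_integral => w _; rewrite shE.
have mphi0 := measurableT_comp mphi (@measurable_coordinate _ S 0).
rewrite (integral_setI_preimage Q A (shift n) (stay_above_start h)
  (fun v => conditioned mh h_ge0 h_harmonic Ph_chain B (coord 0 v))).
rewrite (integral_markov_property mh h_ge0 h_harmonic Ph_chain Q_chain HA);
  last 2 first.
- exact: measurable_patch.
- by move=> v; apply: erestrict_ge0.
rewrite (markov_property mh h_ge0 h_harmonic Ph_chain Q_chain HA);
  last exact: measurableI.
apply: eq_integral => w _; rewrite -integral_mkcond.
exact: integral_conditioned.
Qed.

(** Restricting [spliced_law_pos] to states of positive height only costs null
    sets.  In this form the past and the future of the glued process jointly
    have the law of the past and the future of the transformed chain. *)
Lemma spliced_law n A B : history coord n A -> measurable B ->
  Pr (tX @^-1` (A `&` record_at h n) `&` [set w | T w = n%:R%:E] `&`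
      trajectory Xhat @^-1` B) =
  Q (A `&` record_at h n `&` never_passes h n `&` shift n @^-1` B).
Proof.
move=> HA mB; set F := A `&` record_at h n.
have HF : history coord n F.
  by rewrite history_measE; apply: measurableI => //; exact: history_record_at.
have HFp : history coord n (F `&` pos_at n).
  by rewrite history_measE; apply: measurableI => //; exact: history_pos_at.
have mF := history_coordinate_measurable HF.
have mFp := history_coordinate_measurable HFp.
have mp := history_coordinate_measurable (@history_pos_at n).
have mN := measurable_never_passes mh n.
have mS := measurable_stay_above_start mh.
have mshift (C : set (paths S)) : measurable C -> measurable (shift n @^-1` C).
  by move=> mC; rewrite -[X in measurable X]setTI; exact: measurable_shift.
(* The last record is above the level, which is almost surely positive. *)
transitivity (Pr (tX @^-1` (F `&` pos_at n) `&` [set w | T w = n%:R%:E] `&`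
    trajectory Xhat @^-1` B)).
  apply: (eq_measure_null (measurable_exceptional mh U X_chain) _ _
    (exceptional_null mh h_ge0 h_harmonic X_chain Q_chain U_uniform XU_indep)).
  - by rewrite -setIA; apply: measurableI; [exact: mtXE|exact: mXhatE].
  - by rewrite -setIA; apply: measurableI; [exact: mtXE|exact: mXhatE].
  move=> w /not_orP[/contrapT /= Uh /negP U0]; rewrite -ltNge in U0.
  split=> [[[Fw Tn] Bw]|[[[Fw _] Tn] Bw]]; split=> //; split=> //; split=> //.
  apply: (lt_le_trans U0); move/last_record_nat : Tn => [+ _].
  by case: n {HA F HF HFp mF mFp mp mN mshift Fw} => // n /(_ 0%N isT) /andP[].
rewrite spliced_law_pos//; last by move=> w [[]].
apply: (eq_measure_null (measurableC mp) _ _ (pos_at_full n)).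
- by apply: measurableI => //; apply: mshift; exact: measurableI.
- by apply: measurableI; [exact: measurableI|exact: mshift].
move=> w /contrapT pw.
have shE i : height h (shift n w) i = height h w (n + i)%N by [].
split=> [[[[Aw rw] _] [Bw sw]]|[[[Aw rw] nw] Bw]].
  do 2 split=> //; apply/(no_passage_stay rw) => i.
  by have := sw i; rewrite !shE addn0.
split=> //; split=> // i; rewrite !shE addn0.
by move/(no_passage_stay rw) : nw; exact.
Qed.

Local Notation Xbar := (splice T X Xhat).

Lemma splice_before n w : n%:R%:E < T w -> Xbar n w = X n w.
Proof. by rewrite /splice => ->. Qed.

Lemma splice_after n w i : T w = n%:R%:E -> Xbar (n + i)%N w = Xhat i w.
Proof.
move=> Tn; rewrite /splice Tn time_index_nat addKn.
by rewrite lte_fin ltr_nat ltnNge leq_addr.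
Qed.

Lemma measurable_splice n : measurable_fun setT (Xbar n).
Proof.
move=> _ B mB; rewrite setTI.
rewrite (_ : _ @^-1` B = ([set w | n%:R%:E < T w] `&` X n @^-1` B) `|`
   (\bigcup_(m in [set m | (m <= n)%N]) ([set w | T w = m%:R%:E] `&`
      ([set w | T w < +oo] `&` Xhat (n - m)%N @^-1` B)))).
  apply: measurableU.
    apply: measurableI => //.
    by rewrite -[X in measurable X]setTI; exact: mX.
  apply: bigcup_measurable => m _; apply: measurableI => //.
  exact: mXhat measurable_last_record_ltey _ mB.
apply/seteqP; split=> w; last first.
  move=> [[/= nT Bw]|[m /= mn [/= Tm [_ Bw]]]]; first by rewrite splice_before.
  by rewrite -(subnKC mn) (splice_after _ Tm).
have [nT|nT] := pselect (n%:R%:E < T w).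
  by rewrite /= splice_before//; left.
have [m Tm] : exists m, T w = m%:R%:E.
  apply: last_record_ltey; move/negP : nT; rewrite -leNgt => /le_lt_trans.
  by apply; exact: ltry.
have mn : (m <= n)%N.
  by rewrite leqNgt; apply/negP => nm; apply: nT; rewrite Tm lte_fin ltr_nat.
rewrite /= -{1}(subnKC mn) (splice_after _ Tm) => Bw; right; exists m => //.
by split=> //; rewrite /= Tm; split=> //; exact: ltry.
Qed.

Let mtXbar : measurable_fun setT (trajectory Xbar).
Proof. by apply: measurable_trajectory => n; exact: measurable_splice. Qed.

Section cylinders.
Variables (k : nat) (B : nat -> set S).
Hypothesis mB : forall i, measurable (B i).
Local Notation C := (cylinder coord k B).

Let HC : history coord k C.
Proof. by apply: history_cylinder; exists B. Qed.

Let mC : measurable C.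
Proof. exact: history_coordinate_measurable HC. Qed.

(** Where the last record time is [n], the cylinder splits into conditions on
   [X] strictly before [n] and on [Xhat], whose time [0] is time [n]. *)
Let spliced_cylinder_eq n : (n <= k)%N ->
  Pr (trajectory Xbar @^-1` C `&` [set w | T w = n%:R%:E]) =
  Q (C `&` (record_at h n `&` never_passes h n)).
Proof.
move=> nk.
pose A : set (paths S) := [set w | forall i, (i < n)%N -> B i (coord i w)].
pose C' := cylinder coord (k - n) (fun i => B (n + i)%N).
have HA : history coord n A.
  rewrite history_measE (_ : A =
      \bigcap_(i in [set i | (i < n)%N]) (coord i @^-1` B i))//.
  apply: bigcap_measurableType => i /= iltn.
  rewrite -[X in measurable X]setTI.
  exact: (measurable_hist_fun (ltnW iltn)).
have mC' : measurable C'.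
  apply: (@history_coordinate_measurable _ S (k - n)).
  by apply: history_cylinder; exists (fun i => B (n + i)%N).
have CE (w : paths S) : C w <-> A w /\ C' (shift n w).
  split=> [Cw|[Aw Cw] i ik].
    split=> [i iltn|i ik]; first by apply: Cw; exact: leq_trans (ltnW iltn) nk.
    by apply: Cw; rewrite -(subnKC nk) leq_add2l.
  have [/Aw//|ni] := ltnP i n.
  by rewrite -(subnKC ni); apply: Cw; exact: leq_sub2r.
transitivity (Pr (tX @^-1` (A `&` record_at h n) `&`
    [set w | T w = n%:R%:E] `&` trajectory Xhat @^-1` C')).
  congr (Pr _); apply/seteqP; split=> w.
    move=> [/CE[Aw Cw] /= Tn]; split; last first.
      move=> i ik; have := Cw i ik.
      by rewrite /coordinate /shift /trajectory splice_after.
    split=> //; move/last_record_nat : (Tn) => [rn _]; split.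
      move=> i iltn; have := Aw i iltn; rewrite /coordinate /trajectory.
      by rewrite splice_before// Tn lte_fin ltr_nat.
    by move=> i /rn /andP[].
  move=> [[[Aw rw] /= Tn] Cw]; split=> //; apply/CE; split=> i ik.
    have := Aw i ik; rewrite /coordinate /trajectory.
    by rewrite splice_before// Tn lte_fin ltr_nat.
  by have := Cw i ik; rewrite /coordinate /shift /trajectory splice_after.
rewrite spliced_law//; congr (Q _); apply/seteqP; split=> w.
  by move=> [[[Aw rw] nw] Cw]; split=> //; apply/CE.
by move=> [/CE[Aw Cw] [rw nw]].
Qed.

Let spliced_cylinder_le j : (j <= k)%N ->
  Pr (trajectory Xbar @^-1` C `&` ~` [set w | j%:R%:E < T w]) =
  Q (C `&` never_passes h j).
Proof.
have mPC : measurable (trajectory Xbar @^-1` C).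
  by rewrite -[X in measurable X]setTI; exact: mtXbar.
elim: j => [_|j IHj jk].
  rewrite (_ : ~` _ = [set w | T w = 0%:R%:E]); last first.
    by apply/seteqP; split=> w /last_record0.
  rewrite spliced_cylinder_eq//; congr (Q (_ `&` _)).
  by apply/seteqP; split=> // w [].
rewrite (_ : ~` [set w | j.+1%:R%:E < T w] =
    ~` [set w | j%:R%:E < T w] `|` [set w | T w = j.+1%:R%:E]); last first.
  by apply/seteqP; split=> w /last_recordS.
rewrite setIUr measureU; last 3 first.
- by apply: measurableI => //; exact: measurableC.
- exact: measurableI.
- apply/seteqP; split=> // w [[_ nT] [_ /= Tj]]; apply: nT.
  by rewrite /= Tj lte_fin ltr_nat.
rewrite [X in X + _](IHj (ltnW jk)) [X in _ + X](spliced_cylinder_eq jk).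
have mN i := measurable_never_passes mh i.
have mR i := measurable_record_at mh i.
rewrite -measureU; last 3 first.
- exact: measurableI.
- by apply: measurableI => //; exact: measurableI.
- apply/seteqP; split=> // w [[_ nj] [_ [rj _]]].
  exact: no_passage_record nj rj.
rewrite -setIUr; congr (Q (_ `&` _)).
by apply/seteqP; split=> w /no_passageS.
Qed.

(** Where the last record time exceeds [k] the cylinder is an event for [X], so
    [law_last_record_gt] applies; the rest is the sum over its values up to
    [k]. *)
Lemma spliced_cylinder : Pr (trajectory Xbar @^-1` C) = Q C.
Proof.
have mPC : measurable (trajectory Xbar @^-1` C).
  by rewrite -[X in measurable X]setTI; exact: mtXbar.
rewrite (measureDI Pr mPC (mGt k)) setDE.
rewrite [X in X + _](spliced_cylinder_le (leqnn k)) addeC.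
rewrite (measureDI Q mC (measurable_never_passes mh k)) setDE; congr (_ + _).
rewrite -[RHS](law_last_record_gt mh h_ge0 h_harmonic X_chain Q_chain U_uniform
  XU_indep HC).
congr (Pr _); apply/seteqP; split=> w [Cw /= kT]; split=> // i ik.
  have := Cw i ik; rewrite /coordinate /trajectory splice_before//.
  by apply: le_lt_trans kT; rewrite lee_fin ler_nat.
have := Cw i ik; rewrite /coordinate /trajectory splice_before//.
by apply: le_lt_trans kT; rewrite lee_fin ler_nat.
Qed.

End cylinders.

Lemma spliced_path_law (B : set (paths S)) : measurable B ->
  Pr (trajectory Xbar @^-1` B) = Q B.
Proof.
move=> mB.
transitivity (restr_law Pr measurableT mtXbar B).
  by rewrite -[X in Pr X]setTI; exact/esym/restr_lawE.
apply: (eq_measure_pi_system (@all_cylinders_measurable _ S)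
  (@all_cylindersI _ S) (@all_cylindersT _ S)).
- by rewrite (le_lt_trans sprobability_setT)// ltry.
- move=> _ [k _ [C mC ->]]; rewrite -[RHS](spliced_cylinder k mC).
  by rewrite -[X in _ = Pr X]setTI; exact: restr_lawE.
- exact: measurable_sub_all_cylinders.
Qed.

End splice_law.

(** Being a Markov chain is a property of the law on the path space. *)
Lemma markov_chain_of_path_law d (S : measurableType d) (R : realType)
    dO (Omega : measurableType dO) (M : probability Omega R)
    (Q : probability (paths S) R) (D : set S) (K : S -> set S -> \bar R) (x : S)
    (X : nat -> Omega -> S) :
  measurable D -> (forall y B, 0 <= K y B) ->
  (forall B, measurable B -> measurable_fun setT (K ^~ B)) ->
  (forall n, measurable_fun setT (X n)) ->
  (forall B, measurable B -> M (trajectory X @^-1` B) = Q B) ->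
  markov_chain Q D K x (@coordinate d S) -> markov_chain M D K x X.
Proof.
move=> mD K0 mK mX MQ [mc cD c0 cK]; have mtX := measurable_trajectory mX.
have mpre n (B : set S) : measurable B -> measurable (@coordinate d S n @^-1` B).
  by move=> mB; rewrite -[X in measurable X]setTI; exact: mc.
split=> //.
- move=> n; exists (X n @^-1` ~` D); split.
  + by rewrite -[X in measurable X]setTI; apply: mX => //; exact: measurableC.
  + rewrite (MQ _ (mpre n _ (measurableC mD))).
    have [N [mN N0 DN]] := cD n.
    apply: (subset_measure0 _ mN _ N0); last exact: DN.
    by apply: mpre; exact: measurableC.
  + by [].
- by move=> B mB; rewrite (MQ _ (mpre 0%N _ mB)) c0.
- move=> n _ B /history_trajectory[A HA ->] mB.
  have mA := history_coordinate_measurable HA.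
  rewrite (MQ _ (measurableI _ _ mA (mpre n.+1 _ mB))) cK//.
  have mKc := measurableT_comp (mK _ mB) (mc n).
  transitivity (\int[M]_w
      ((fun v => K (coordinate n v) B) \_ A) (trajectory X w)).
    rewrite integral_mkcond -(integral_restr_law M measurableT mtX)//;
      last 2 first.
    + exact: measurable_patch.
    + by move=> v; exact: erestrict_ge0.
    apply: eq_measure_integral => C mC _.
    transitivity (M (trajectory X @^-1` C)); first exact/esym/MQ.
    by rewrite -[X in M X]setTI; exact/esym/restr_lawE.
  by rewrite [RHS]integral_mkcond; apply: eq_integral => w _; rewrite !patchE.
Qed.

Theorem theorem3 (R : realType) (d : measure_display) (S : measurableType d)
  (P : R.-pker S ~> S) (h : S -> R)
  (mh : measurable_fun setT h)
  (h_ge0 : forall x, (0 <= h x)%R)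
  (h_harmonic : harmonic_wrt P h)
  (o : S) (ho : (0 < h o)%R)
  (* P^h_x, x in S^h, realized on the path space; the values of Ph outside S^h
     are irrelevant *)
  (Ph : S -> probability (paths S) R)
  (Ph_chain : forall x, positivity_set h x ->
     markov_chain (Ph x) (positivity_set h) (htransform P h) x (@coordinate d S))
  (dO : measure_display) (Omega : measurableType dO)
  (Pr : probability Omega R)
  (X : nat -> Omega -> S)
  (X_chain : markov_chain Pr setT (fun x A => P x A) o X)
  (U : {RV Pr >-> R})
  (U_uniform : forall A : set R, measurable A ->
     distribution Pr U A = uniform_prob ho A)
  (XU_indep : independent_rv Pr (trajectory X) U) :
  let T : Omega -> \bar R := fun w => last_record (fun n => h (X n w)) (U w) in
  let XT : Omega -> S := fun w => X (time_index (T w)) w in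
  forall (Xhat : nat -> Omega -> S)
    (mXhat : forall n, measurable_fun [set w | T w < +oo] (Xhat n))
    (Xhat0 : {ae Pr, forall w, T w < +oo -> Xhat 0%N w = XT w})
    (* P^h_x only makes sense for x in S^h; {T < +oo, XT \notin S^h} is null *)
    (Xhat_law : conditional_law_on Pr
       [set w | T w < +oo /\ positivity_set h (XT w)]
       (fun w => (trajectory X w, U w : R)) (trajectory Xhat)
       (fun w => cond_prob (Ph (XT w)) (stay_above h (h (XT w))))),
  let Xbar := splice T X Xhat in
  markov_chain Pr (positivity_set h) (htransform P h) o Xbar /\
  forall B : set (paths S), measurable B ->
    Pr (trajectory Xbar @^-1` B) = Ph o B.
Proof.
move=> T XT Xhat mXhat _ Xhat_law Xbar.
have law B : measurable B -> Pr (trajectory Xbar @^-1` B) = Ph o B.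
  exact: (spliced_path_law mh h_ge0 h_harmonic Ph_chain X_chain U_uniform
    XU_indep mXhat Xhat_law).
split=> //; apply: markov_chain_of_path_law law (Ph_chain o ho).
- by rewrite -[X in measurable X]setTI; exact: measurable_fun_ltr.
- by move=> y B; exact: (measure_ge0 (htransform_kernel mh h_ge0 h_harmonic y)).
- exact: (measurable_kernel (htransform_kernel mh h_ge0 h_harmonic)).
- exact: (measurable_splice mh X_chain mXhat).
Qed.
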